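(* Let $\mathcal{M}$ be a smooth manifold with Riemannian metric $g$, let $\nabla$ be an affine connection on $\mathcal{M}$ and $\nabla^{\star}$ its torsion dual, and suppose that both $\nabla$ and $\nabla^{\star}$ are metric ($\nabla g=0$ and $\nabla^{\star}g=0$). Let $N$ be the distortion tensor of $\nabla$. Then the curvature tensors of the two connections obey $$R_{ijkl}+R^{\star}_{jikl}=4\nabla^{(0)}_{[k}N_{|ij|l]}.$$ In addition, flatness of $\nabla$ does not in general imply flatness of $\nabla^{\star}$ (i.e. there exist a smooth manifold $\mathcal{M}$ with Riemannian metric $g$ and an affine connection $\nabla$ on $\mathcal{M}$ with torsion dual $\nabla^{\star}$, satisfying $\nabla g=0$ and $\nabla^{\star}g=0$, with $\nabla$ flat and $\nabla^{\star}$ not flat); rather, if $\nabla$ is flat, then the curvature of $\nabla^{\star}$ is given by $$R^{\star}_{jikl}=4\nabla^{(0)}_{[k}N_{|ij|l]}.$$ Equivalently, $$R^{\star}_{ijkl}=0\iff R_{ijkl}=4\nabla^{(0)}_{[k}N_{|ij|l]}.$$ Consequently, if one of the two connections is flat, then the other one is flat as well if and only if $\nabla^{(0)}_{[k}N_{|ij|l]}=0$.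
   Context: All objects are smooth. Connection coefficients are defined by $\nabla_{\partial_i}\partial_j=\Gamma^{k}{}_{ji}\partial_k$ (note the index order); likewise for other connections. Torsion dual: the torsion dual connection $\nabla^{\star}$ of an affine connection $\nabla$ is the affine connection defined by $\nabla_XY-\nabla^{\star}_YX-[X,Y]=0$ for all smooth vector fields $X,Y$; in local coordinates, $\Gamma^{\star\, i}{}_{kj}=\Gamma^{i}{}_{jk}$. Distortion: $\nabla^{(0)}$ denotes the Levi-Civita connection of $g$, with coefficients $\Gamma^{(0)m}{}_{ij}$. The distortion tensor $N$ of $\nabla$ is defined by $\Gamma^{m}{}_{ij}=\Gamma^{(0)m}{}_{ij}+N^{m}{}_{ij}$, and $N_{ijk}=g_{im}N^{m}{}_{jk}$. Curvature: $R(X,Y)Z=\nabla_X\nabla_YZ-\nabla_Y\nabla_XZ-\nabla_{[X,Y]}Z$, with components $R(\partial_i,\partial_j)\partial_k=R^{m}{}_{kij}\partial_m$ and $R_{ijkl}=g_{im}R^{m}{}_{jkl}$; $R^{\star}$ is the curvature of $\nabla^{\star}$ with the same conventions. A connection is flat if its curvature tensor vanishes identically. Index notation: $[k\,|ij|\,l]$ denotes antisymmetrization in $k,l$ only, with factor $\tfrac12$, i.e. $\nabla^{(0)}_{[k}N_{|ij|l]}=\tfrac12\big(\nabla^{(0)}_kN_{ijl}-\nabla^{(0)}_lN_{ijk}\big)$. *)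

(* Defs.v *)
From HB Require Import structures.
From mathcomp Require Import all_boot all_order all_algebra.
From mathcomp Require Import all_classical all_reals all_analysis.

Set Implicit Arguments.
Unset Strict Implicit.
Unset Printing Implicit Defensive.

Import Order.TTheory GRing.Theory Num.Theory.
Import numFieldNormedType.Exports.

Local Open Scope classical_set_scope.
Local Open Scope ring_scope.

Definition partial (R : realType) (n : nat) (i : 'I_n) (f : 'rV[R]_n -> R) :
    'rV[R]_n -> R :=
  fun x => 'D_'e_i f x.

(* C^oo on an open set U: every iterated partial derivative (including f
   itself, s = [::]) is differentiable on U.  Functions are total, but only
   their values on U matter since U is open. *)
Definition smooth_on (R : realType) (n : nat) (U : set 'rV[R]_n)
    (f : 'rV[R]_n -> R) : Prop :=
  forall (s : seq 'I_n) (x : 'rV[R]_n),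
    U x -> differentiable (foldr (@partial R n) f s) x.

Definition smooth_map_on (R : realType) (n m : nat) (U : set 'rV[R]_n)
    (f : 'rV[R]_n -> 'rV[R]_m) : Prop :=
  forall j : 'I_m, smooth_on U (fun x => f x 0 j).

(* A second countable Hausdorff space with a smooth atlas, not necessarily
   maximal.  The chart [a] is the homeomorphism [chart a] from [cdom a] onto
   [ccod a], with inverse [chartV a]; both are total functions whose values
   off these open sets are irrelevant. *)
Record smoothManifold (R : realType) (n : nat) := SmoothManifold {
  carrier :> topologicalType;
  carrier_hausdorff : hausdorff_space carrier;
  carrier_second_countable : @second_countable carrier;
  atlas : Type;
  cdom : atlas -> set carrier;
  ccod : atlas -> set 'rV[R]_n;
  chart : atlas -> carrier -> 'rV[R]_n;
  chartV : atlas -> 'rV[R]_n -> carrier;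
  cdom_open : forall a, open (cdom a);
  ccod_open : forall a, open (ccod a);
  cdom_cover : forall p, exists a, cdom a p;
  chart_ccod : forall a p, cdom a p -> ccod a (chart a p);
  chartV_cdom : forall a x, ccod a x -> cdom a (chartV a x);
  chartK : forall a p, cdom a p -> chartV a (chart a p) = p;
  chartVK : forall a x, ccod a x -> chart a (chartV a x) = x;
  chart_continuous : forall a, {within cdom a, continuous (chart a)};
  chartV_continuous : forall a, {within ccod a, continuous (chartV a)};
  transition_smooth : forall a b,
    smooth_map_on [set x | ccod a x /\ cdom b (chartV a x)]
      (chart b \o chartV a)
}.

Definition smooth_fun (R : realType) (n : nat) (M : smoothManifold R n)
    (U : set M) (f : M -> R) : Prop :=
  forall a : atlas M,
    smooth_on [set x | ccod a x /\ U (chartV a x)] (f \o chartV a).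

(* Jacobian at p of the change of coordinates from chart a to chart b. *)
Definition transitionJ (R : realType) (n : nat) (M : smoothManifold R n)
    (a b : atlas M) (p : M) : 'M[R]_n :=
  'J (chart b \o chartV a) (chart a p).

(* Vector fields are given by their components: [X p a] is the row of
   components of X at p in the chart a, meaningful when [cdom a p]. *)
Definition vfield (R : realType) (n : nat) (M : smoothManifold R n) : Type :=
  M -> atlas M -> 'rV[R]_n.

(* X is a smooth vector field on the open set U; its values off U are
   irrelevant. *)
Record smooth_vfield (R : realType) (n : nat) (M : smoothManifold R n)
    (U : set M) (X : vfield M) : Prop := SmoothVfield {
  vfield_transform : forall (a b : atlas M) (p : M),
    U p -> cdom a p -> cdom b p -> X p b = X p a *m transitionJ a b p;
  vfield_smooth : forall a : atlas M,
    smooth_map_on [set x | ccod a x /\ U (chartV a x)]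
      (fun x => X (chartV a x) a)
}.

Definition agree_on (R : realType) (n : nat) (M : smoothManifold R n)
    (U : set M) (X Y : vfield M) : Prop :=
  forall (p : M) (a : atlas M), U p -> cdom a p -> X p a = Y p a.

Definition vadd (R : realType) (n : nat) (M : smoothManifold R n)
    (X Y : vfield M) : vfield M :=
  fun p a => X p a + Y p a.

Definition vscale (R : realType) (n : nat) (M : smoothManifold R n)
    (f : M -> R) (X : vfield M) : vfield M :=
  fun p a => f p *: X p a.

(* (X f)(p), computed in the chart a. *)
Definition vderive (R : realType) (n : nat) (M : smoothManifold R n)
    (a : atlas M) (X : vfield M) (f : M -> R) (p : M) : R :=
  'D_(X p a) (f \o chartV a) (chart a p).

(* [X, Y]^i = X^j d_j Y^i - Y^j d_j X^i. *)
Definition lie_bracket (R : realType) (n : nat) (M : smoothManifold R n)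
    (X Y : vfield M) : vfield M :=
  fun p a => 'D_(X p a) (fun x => Y (chartV a x) a) (chart a p)
           - 'D_(Y p a) (fun x => X (chartV a x) a) (chart a p).

(* The field d/dx^i of the chart a, smooth on [cdom a]. *)
Definition coord_field (R : realType) (n : nat) (M : smoothManifold R n)
    (a : atlas M) (i : 'I_n) : vfield M :=
  fun p b => row i (transitionJ a b p).

(* An affine connection: on every open set U, an operator on the smooth vector
   fields on U that is C^oo(U)-linear in the first argument and additive and
   Leibniz in the second, compatibly with restriction to smaller open sets.
   The operators for all U are packed as a single [cov] on total families:
   [cov_local] for the given U expresses both that [cov X Y] on U depends only
   on X and Y on U, and the compatibility with restriction. *)
Record connection (R : realType) (n : nat) (M : smoothManifold R n) :=
  Connection {
  cov :> vfield M -> vfield M -> vfield M;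
  cov_smooth : forall (U : set M) (X Y : vfield M), open U ->
    smooth_vfield U X -> smooth_vfield U Y -> smooth_vfield U (cov X Y);
  cov_local : forall (U : set M) (X X' Y Y' : vfield M), open U ->
    smooth_vfield U X -> smooth_vfield U X' ->
    smooth_vfield U Y -> smooth_vfield U Y' ->
    agree_on U X X' -> agree_on U Y Y' -> agree_on U (cov X Y) (cov X' Y');
  covDl : forall (U : set M) (X X' Y : vfield M), open U ->
    smooth_vfield U X -> smooth_vfield U X' -> smooth_vfield U Y ->
    agree_on U (cov (vadd X X') Y) (vadd (cov X Y) (cov X' Y));
  covZl : forall (U : set M) (f : M -> R) (X Y : vfield M), open U ->
    smooth_fun U f -> smooth_vfield U X -> smooth_vfield U Y ->
    agree_on U (cov (vscale f X) Y) (vscale f (cov X Y));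
  covDr : forall (U : set M) (X Y Y' : vfield M), open U ->
    smooth_vfield U X -> smooth_vfield U Y -> smooth_vfield U Y' ->
    agree_on U (cov X (vadd Y Y')) (vadd (cov X Y) (cov X Y'));
  cov_leibniz : forall (U : set M) (f : M -> R) (X Y : vfield M), open U ->
    smooth_fun U f -> smooth_vfield U X -> smooth_vfield U Y ->
    forall (p : M) (a : atlas M), U p -> cdom a p ->
      cov X (vscale f Y) p a
      = vderive a X f p *: Y p a + f p *: cov X Y p a
}.

(* [gram p a] is the matrix (g_ij) at p in the chart a. *)
Record riemannianMetric (R : realType) (n : nat) (M : smoothManifold R n) :=
  RiemannianMetric {
  gram :> M -> atlas M -> 'M[R]_n;
  gram_sym : forall (p : M) (a : atlas M), cdom a p ->
    (gram p a)^T = gram p a;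
  gram_posdef : forall (p : M) (a : atlas M), cdom a p ->
    forall v : 'rV[R]_n, v != 0 -> 0 < (v *m gram p a *m v^T) 0 0;
  gram_transform : forall (a b : atlas M) (p : M), cdom a p -> cdom b p ->
    gram p a = transitionJ a b p *m gram p b *m (transitionJ a b p)^T;
  gram_smooth : forall (a : atlas M) (i j : 'I_n),
    smooth_on (ccod a) (fun x => gram (chartV a x) a i j)
}.

(* g(X, Y), computed in the chart a. *)
Definition inner (R : realType) (n : nat) (M : smoothManifold R n)
    (g : riemannianMetric M) (a : atlas M) (X Y : vfield M) : M -> R :=
  fun p => (X p a *m g p a *m (Y p a)^T) 0 0.

(* (nabla_X g)(Y, Z), computed in the chart a. *)
Definition cov_metric (R : realType) (n : nat) (M : smoothManifold R n)
    (nabla : connection M) (g : riemannianMetric M) (a : atlas M)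
    (X Y Z : vfield M) (p : M) : R :=
  vderive a X (inner g a Y Z) p
  - inner g a (nabla X Y) Z p - inner g a Y (nabla X Z) p.

Definition is_metric (R : realType) (n : nat) (M : smoothManifold R n)
    (g : riemannianMetric M) (nabla : connection M) : Prop :=
  forall (U : set M) (X Y Z : vfield M), open U ->
    smooth_vfield U X -> smooth_vfield U Y -> smooth_vfield U Z ->
    forall (p : M) (a : atlas M), U p -> cdom a p ->
      cov_metric nabla g a X Y Z p = 0.

Definition torsion_dual (R : realType) (n : nat) (M : smoothManifold R n)
    (nabla nablas : connection M) : Prop :=
  forall (U : set M) (X Y : vfield M), open U ->
    smooth_vfield U X -> smooth_vfield U Y ->
    forall (p : M) (a : atlas M), U p -> cdom a p ->
      nabla X Y p a - nablas Y X p a - lie_bracket X Y p a = 0.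

Definition torsion_free (R : realType) (n : nat) (M : smoothManifold R n)
    (nabla : connection M) : Prop :=
  forall (U : set M) (X Y : vfield M), open U ->
    smooth_vfield U X -> smooth_vfield U Y ->
    forall (p : M) (a : atlas M), U p -> cdom a p ->
      nabla X Y p a - nabla Y X p a - lie_bracket X Y p a = 0.

Definition levi_civita (R : realType) (n : nat) (M : smoothManifold R n)
    (g : riemannianMetric M) (nabla0 : connection M) : Prop :=
  is_metric g nabla0 /\ torsion_free nabla0.

Definition curvature (R : realType) (n : nat) (M : smoothManifold R n)
    (nabla : connection M) (X Y Z : vfield M) : vfield M :=
  fun p a => nabla X (nabla Y Z) p a - nabla Y (nabla X Z) p a
             - nabla (lie_bracket X Y) Z p a.

Definition flat (R : realType) (n : nat) (M : smoothManifold R n)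
    (nabla : connection M) : Prop :=
  forall (U : set M) (X Y Z : vfield M), open U ->
    smooth_vfield U X -> smooth_vfield U Y -> smooth_vfield U Z ->
    forall (p : M) (a : atlas M), U p -> cdom a p ->
      curvature nabla X Y Z p a = 0.

(* R^m_{kij}, where R(d_i, d_j) d_k = R^m_{kij} d_m. *)
Definition curv_coef (R : realType) (n : nat) (M : smoothManifold R n)
    (nabla : connection M) (a : atlas M) (m k i j : 'I_n) (p : M) : R :=
  curvature nabla (coord_field a i) (coord_field a j) (coord_field a k)
    p a 0 m.

(* R_{ijkl} = g_im R^m_{jkl}. *)
Definition curv_low (R : realType) (n : nat) (M : smoothManifold R n)
    (g : riemannianMetric M) (nabla : connection M) (a : atlas M)
    (i j k l : 'I_n) (p : M) : R :=
  \sum_(m < n) g p a i m * curv_coef nabla a m j k l p.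

(* Gamma^k_{ji}, where nabla_{d_i} d_j = Gamma^k_{ji} d_k: the direction of
   differentiation is the last index. *)
Definition conn_coef (R : realType) (n : nat) (M : smoothManifold R n)
    (nabla : connection M) (a : atlas M) (k j i : 'I_n) (p : M) : R :=
  nabla (coord_field a i) (coord_field a j) p a 0 k.

(* N^m_{ij} for the distortion of nabla, nabla0 being the Levi-Civita
   connection. *)
Definition distortion (R : realType) (n : nat) (M : smoothManifold R n)
    (nabla0 nabla : connection M) (a : atlas M) (m i j : 'I_n) (p : M) : R :=
  conn_coef nabla a m i j p - conn_coef nabla0 a m i j p.

(* N_{ijk} = g_im N^m_{jk}. *)
Definition distortion_low (R : realType) (n : nat) (M : smoothManifold R n)
    (g : riemannianMetric M) (nabla0 nabla : connection M) (a : atlas M)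
    (i j k : 'I_n) (p : M) : R :=
  \sum_(m < n) g p a i m * distortion nabla0 nabla a m j k p.

(* (nabla_{d_k} T)_{ijl} in the chart a, for a (0,3)-tensor with components
   T i j l in that chart. *)
Definition cov_deriv3 (R : realType) (n : nat) (M : smoothManifold R n)
    (nabla : connection M) (a : atlas M) (T : 'I_n -> 'I_n -> 'I_n -> M -> R)
    (k i j l : 'I_n) (p : M) : R :=
  'D_'e_k (T i j l \o chartV a) (chart a p)
  - \sum_(m < n) (conn_coef nabla a m i k p * T m j l p
                  + conn_coef nabla a m j k p * T i m l p
                  + conn_coef nabla a m l k p * T i j m p).

(* nabla0_{[k} N_{|ij|l]} = (nabla0_k N_{ijl} - nabla0_l N_{ijk}) / 2. *)
Definition skew_cov_distortion (R : realType) (n : nat)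
    (M : smoothManifold R n) (g : riemannianMetric M)
    (nabla0 nabla : connection M) (a : atlas M) (i j k l : 'I_n) (p : M) : R :=
  2^-1 * (cov_deriv3 nabla0 a (distortion_low g nabla0 nabla a) k i j l p
          - cov_deriv3 nabla0 a (distortion_low g nabla0 nabla a) l i j k p).

(* Main.v *)
Require Import Defs.
From HB Require Import structures.
From mathcomp Require Import all_boot all_order all_algebra.
From mathcomp Require Import all_classical all_reals all_analysis.
From mathcomp Require Import ring lra.

(** In a chart, write the coefficients of a connection as matrices G_k whose
    j-th row holds the components of nabla_(d_k) d_j.  A field with component
    row Z then has nabla_(d_k) Z = d_k Z + Z G_k, the curvature is
    R_kl = d_k G_l - d_l G_k + G_l G_k - G_k G_l, and nabla is metric exactly
    when d_k g = G_k g + g G_k^T.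

    Curvature identity.  Let G = G0 + N with G0 the Levi-Civita coefficients.
    Subtracting the metric equations of nabla and nabla0 shows that N_ijk is
    skew in i, j.  The torsion dual exchanges the two lower indices of the
    coefficients, so its distortion is N_ikj; it is metric too, hence N_ikj is
    skew in i, j as well, and N is totally skew.  Therefore the distortion of
    the torsion dual is -N ([torsion_dual_distortion]).  In the difference of
    the curvatures of G0 + N and G0 - N, the terms of even degree in N cancel
    and the terms of odd degree make up twice the alternated Levi-Civita
    derivative of N.  Since the curvature Rs of the torsion dual, a metric
    connection, is skew in its first two lowered indices ([curv_mx_metric]),
    the difference R_ijkl - Rs_ijkl is the sum R_ijkl + Rs_jikl
    ([curv_mx_dual], [curvature_torsion_dual]).  The assertions about flatness
    follow, because the curvature is tensorial ([curvature_in_chart]) and so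
    vanishes as soon as its components in charts do ([flatP],
    [flat_curv_low]).  Tensoriality and skewness both rest on the symmetry of
    second derivatives ([schwarz]).

    Flat connection with a curved torsion dual.  Compact Lie groups with a
    bi-invariant metric are of no use here, as their two canonical connections
    are both flat; the example is the sphere S^7, parallelized by the unit
    octonions.  In the stereographic chart x |-> (1 + x)(1 - x)^-1, with x an
    imaginary octonion, the left-invariant fields are
    E_e(x) = (1 + x) e (1 - x) / 2 = (1 - |x|^2)/2 e + <x, e> x + x >< e,
    where >< is the cross product of imaginary octonions.  They are quadratic
    in x, and the round metric is ((1 + |x|^2)/2)^-2 times the Euclidean one.
    So the whole example lives on R^7 with one chart.  The connection making the
    E_e parallel is flat and metric; its torsion dual is metric as well, by two
    properties of the structure constants of the cross product: they alternate,
    and a >< (a >< b) = <a, b> a - |a|^2 b.  At the origin, a component of the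
    curvature of the torsion dual is a sum of products of structure constants
    that measures the failure of associativity, and it is nonzero for suitable
    octonion units ([oct_const_dual_curved]). *)

Set Implicit Arguments.
Unset Strict Implicit.
Unset Printing Implicit Defensive.

Import Order.TTheory GRing.Theory Num.Theory.
Import numFieldNormedType.Exports.

Local Open Scope classical_set_scope.
Local Open Scope ring_scope.

(** * Smooth functions on open subsets of R^n *)

(** The first-order expansion of [f] at [x] is also one of [g]. *)
Lemma near_eq_differentiable (R : realType) (V W : normedModType R)
    (f g : V -> W) (x : V) :
  {near x, f =1 g} -> differentiable f x -> differentiable g x.
Proof.
move=> fg df.
have fgx : f x = g x := nbhs_singleton fg.
have [cdf fE] := (diff_locallyP x f).1 df.
have gE : g \o shift x = cst (g x) + 'd f x +o_ (0 : V) id.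
  apply/eqaddoP => e e0.
  have /eqaddoP/(_ e e0) := fE.
  have : \forall y \near (0 : V), f (y + x) = g (y + x).
    by move: fg; rewrite (near_shift 0) /=; apply: filterS => y /=; rewrite subr0.
  apply: filterS2 => y fgy.
  by rewrite /= !fctE /= fgy fgx.
by apply/diff_locallyP; rewrite (diff_unique cdf gE).
Qed.

Lemma open_near (T : topologicalType) (U : set T) (x : T) (P : T -> Prop) :
  open U -> U x -> (forall y, U y -> P y) -> \forall y \near x, P y.
Proof. by move=> oU Ux UP; apply: filterS UP _; exact: open_nbhs_nbhs. Qed.

Section Smooth.
Variables (R : realType) (n : nat).
Implicit Types (U : set 'rV[R]_n) (f g : 'rV[R]_n -> R).

(** Smoothness cut off at order [k].  The partial derivatives of a product, an
    inverse or a composite are sums of products, hence no longer of the same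
    shape; induction on the order needs only closure under sums and products. *)
Definition diff_upto (k : nat) U f :=
  forall (s : seq 'I_n) x, (size s <= k)%N -> U x ->
    differentiable (foldr (@partial R n) f s) x.

Lemma smooth_onP U f : smooth_on U f <-> forall k, diff_upto k U f.
Proof.
split=> [sf k s x _|df s x Ux]; first exact: sf.
exact: (df (size s)).
Qed.

Lemma diff_upto0 k U f x : diff_upto k U f -> U x -> differentiable f x.
Proof. by move=> df Ux; apply: (df [::]). Qed.

Lemma smooth_diff U f x : smooth_on U f -> U x -> differentiable f x.
Proof. by move=> df Ux; apply: (df [::]). Qed.

(** Iterated derivatives apply the head of the list last, so it is the last
    entry of the list that is peeled off. *)
Lemma diff_uptoS k U f : diff_upto k.+1 U f <->
  (forall x, U x -> differentiable f x) /\ forall i, diff_upto k U (partial i f).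
Proof.
split=> [df|[df dpf]].
  split=> [x Ux|i s x sk Ux]; first exact: (df [::]).
  by rewrite -foldr_rcons; apply: df; rewrite ?size_rcons.
move=> s x; case/lastP: s => [_|s i]; first exact: df.
by rewrite size_rcons ltnS foldr_rcons; apply: dpf.
Qed.

Lemma diff_upto_le k U f : diff_upto k.+1 U f -> diff_upto k U f.
Proof. by move=> df s x sk; apply: df; exact: leqW. Qed.

Lemma smooth_partial U f i : smooth_on U f -> smooth_on U (partial i f).
Proof.
move=> /smooth_onP sf; apply/smooth_onP => k.
exact: ((diff_uptoS k U f).1 (sf k.+1)).2.
Qed.

Lemma partial_eq_on U f g i : open U -> (forall x, U x -> f x = g x) ->
  forall x, U x -> partial i f x = partial i g x.
Proof. by move=> oU fg x Ux; apply: near_eq_derive; exact: open_near fg. Qed.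

Lemma diff_upto_eq k U f g : open U -> (forall x, U x -> f x = g x) ->
  diff_upto k U f -> diff_upto k U g.
Proof.
move=> oU; have deq f' g' : (forall x, U x -> f' x = g' x) ->
    (forall x, U x -> differentiable f' x) ->
    forall x, U x -> differentiable g' x.
  move=> fg df x Ux; apply: near_eq_differentiable (df _ Ux).
  exact: open_near fg.
elim: k f g => [|k IH] f g fg df.
  move=> [|//] x _ Ux /=; apply: deq fg _ _ Ux => y Uy.
  exact: diff_upto0 df Uy.
have [df0 dfi] := (diff_uptoS k U f).1 df.
apply/diff_uptoS; split; first exact: deq fg df0.
by move=> i; apply: IH (dfi i) => x Ux; exact: partial_eq_on fg _ Ux.
Qed.

Lemma smooth_on_eq U f g : open U -> (forall x, U x -> f x = g x) ->
  smooth_on U f -> smooth_on U g.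
Proof.
move=> oU fg /smooth_onP df; apply/smooth_onP => k.
exact: diff_upto_eq fg (df k).
Qed.

Lemma smooth_on_sub U U' f : U' `<=` U -> smooth_on U f -> smooth_on U' f.
Proof. by move=> UU sf s x /UU; exact: sf. Qed.

Lemma derive_partial f x v : differentiable f x ->
  'D_v f x = \sum_i v 0 i * partial i f x.
Proof.
move=> df; rewrite deriveE // {1}(row_sum_delta v) linear_sum /=.
by apply: eq_bigr => i _; rewrite linearZ /= /partial deriveE.
Qed.

Lemma eq_partial f g i x : f =1 g -> partial i f x = partial i g x.
Proof. by move=> /funext ->. Qed.

Lemma partial_cst (i : 'I_n) c x : partial i (fun=> c : R) x = 0.
Proof. exact: derive_cst. Qed.

Lemma partialD f g i x : differentiable f x -> differentiable g x ->
  partial i (fun y => f y + g y) x = partial i f x + partial i g x.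
Proof. by move=> df dg; apply: deriveD; exact: diff_derivable. Qed.

Lemma partialN f i x : differentiable f x ->
  partial i (fun y => - f y) x = - partial i f x.
Proof. by move=> df; apply: deriveN; exact: diff_derivable. Qed.

Lemma partialB f g i x : differentiable f x -> differentiable g x ->
  partial i (fun y => f y - g y) x = partial i f x - partial i g x.
Proof. by move=> df dg; apply: deriveB; exact: diff_derivable. Qed.

Lemma partialM f g i x : differentiable f x -> differentiable g x ->
  partial i (fun y => f y * g y) x = partial i f x * g x + f x * partial i g x.
Proof.
move=> df dg; rewrite /partial (deriveM (diff_derivable df) (diff_derivable dg)).
by rewrite /GRing.scale /= addrC mulrC.
Qed.

Lemma partialV f i x : differentiable f x -> f x != 0 ->
  partial i (fun y => (f y)^-1) x = - (f x)^-2 * partial i f x.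
Proof. by move=> df fx0; rewrite /partial deriveV//; exact: diff_derivable. Qed.

Lemma differentiable_bigsum (I : Type) (r : seq I) (P : pred I) (h : I -> 'rV[R]_n -> R) x :
  (forall i, P i -> differentiable (h i) x) ->
  differentiable (fun y => \sum_(i <- r | P i) h i y) x.
Proof.
move=> dh; elim: r => [|i r IH].
  by under eq_fun do rewrite big_nil; exact: differentiable_cst.
under eq_fun do rewrite big_cons.
case: (boolP (P i)) => // Pi; exact: differentiableD (dh i Pi) IH.
Qed.

Lemma partial_sum (I : Type) (r : seq I) (h : I -> 'rV[R]_n -> R) j x :
  (forall i, differentiable (h i) x) ->
  partial j (fun y => \sum_(i <- r) h i y) x = \sum_(i <- r) partial j (h i) x.
Proof.
move=> dh; elim: r => [|i r IH].
  by rewrite big_nil -[RHS](partial_cst j 0 x); apply: eq_partial => y; rewrite big_nil.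
rewrite big_cons -IH -partialD //; last exact: differentiable_bigsum.
by apply: eq_partial => y; rewrite big_cons.
Qed.

Lemma diff_upto_cst k U c : diff_upto k U (fun=> c).
Proof.
elim: k c => [|k IH] c; first by move=> [|//] x _ _; exact: differentiable_cst.
apply/diff_uptoS; split=> [x _|i]; first exact: differentiable_cst.
by rewrite (_ : partial i _ = fun=> 0) //; apply/funext => x; exact: partial_cst.
Qed.

Lemma diff_uptoD k U f g : open U ->
  diff_upto k U f -> diff_upto k U g -> diff_upto k U (fun x => f x + g x).
Proof.
move=> oU; elim: k f g => [|k IH] f g df dg.
  move=> [|//] x _ Ux.
  by apply: differentiableD; [exact: diff_upto0 df Ux|exact: diff_upto0 dg Ux].
have [df0 dfi] := (diff_uptoS k U f).1 df.
have [dg0 dgi] := (diff_uptoS k U g).1 dg.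
apply/diff_uptoS; split=> [x Ux|i]; first by apply: differentiableD; auto.
apply: (diff_upto_eq oU _ (IH _ _ (dfi i) (dgi i))) => x Ux.
by rewrite partialD //; auto.
Qed.

Lemma diff_uptoM k U f g : open U ->
  diff_upto k U f -> diff_upto k U g -> diff_upto k U (fun x => f x * g x).
Proof.
move=> oU; elim: k f g => [|k IH] f g df dg.
  move=> [|//] x _ Ux.
  by apply: differentiableM; [exact: diff_upto0 df Ux|exact: diff_upto0 dg Ux].
have [df0 dfi] := (diff_uptoS k U f).1 df.
have [dg0 dgi] := (diff_uptoS k U g).1 dg.
apply/diff_uptoS; split=> [x Ux|i]; first by apply: differentiableM; auto.
apply: (diff_upto_eq oU _ (diff_uptoD oU
  (IH _ _ (dfi i) (diff_upto_le dg)) (IH _ _ (diff_upto_le df) (dgi i)))).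
by move=> x Ux; rewrite partialM //; auto.
Qed.

Lemma diff_uptoV k U f : open U -> (forall x, U x -> f x != 0) ->
  diff_upto k U f -> diff_upto k U (fun x => (f x)^-1).
Proof.
move=> oU f0; elim: k => [|k IH] df.
  by move=> [|//] x _ Ux; apply: differentiableV (f0 _ Ux); exact: diff_upto0 df Ux.
have [df0 dfi] := (diff_uptoS k U f).1 df.
apply/diff_uptoS; split=> [x Ux|i]; first by apply: differentiableV; auto.
have IH' := IH (diff_upto_le df).
apply: (diff_upto_eq oU _ (diff_uptoM oU (diff_uptoM oU
  (diff_uptoM oU (@diff_upto_cst _ _ (-1)) IH') IH') (dfi i))) => x Ux.
by rewrite partialV; auto; rewrite expr2 invfM mulN1r !mulNr.
Qed.

Lemma smooth_cst U c : smooth_on U (fun=> c).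
Proof. by apply/smooth_onP => k; exact: diff_upto_cst. Qed.

Lemma smoothD U f g : open U -> smooth_on U f -> smooth_on U g ->
  smooth_on U (fun x => f x + g x).
Proof.
by move=> oU /smooth_onP sf /smooth_onP sg; apply/smooth_onP => k; exact: diff_uptoD.
Qed.

Lemma smoothM U f g : open U -> smooth_on U f -> smooth_on U g ->
  smooth_on U (fun x => f x * g x).
Proof.
by move=> oU /smooth_onP sf /smooth_onP sg; apply/smooth_onP => k; exact: diff_uptoM.
Qed.

Lemma smoothN U f : open U -> smooth_on U f -> smooth_on U (fun x => - f x).
Proof.
move=> oU sf; have := smoothM oU (@smooth_cst U (-1)) sf.
by apply: smooth_on_eq => // x _; rewrite mulN1r.
Qed.

Lemma smoothB U f g : open U -> smooth_on U f -> smooth_on U g ->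
  smooth_on U (fun x => f x - g x).
Proof. by move=> oU sf sg; apply: smoothD => //; exact: smoothN. Qed.

Lemma smoothV U f : open U -> (forall x, U x -> f x != 0) -> smooth_on U f ->
  smooth_on U (fun x => (f x)^-1).
Proof.
by move=> oU f0 /smooth_onP sf; apply/smooth_onP => k; exact: diff_uptoV.
Qed.

Lemma smooth_sum U (I : Type) (r : seq I) (h : I -> 'rV[R]_n -> R) : open U ->
  (forall i, smooth_on U (h i)) -> smooth_on U (fun x => \sum_(i <- r) h i x).
Proof.
move=> oU sh; elim: r => [|i r IH].
  by under eq_fun do rewrite big_nil; exact: smooth_cst.
by under eq_fun do rewrite big_cons; exact: smoothD.
Qed.

Lemma partial_coord (i j : 'I_n) x :
  partial i (fun y : 'rV[R]_n => y 0 j) x = (i == j)%:R.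
Proof.
rewrite /partial.
have dm : derivable (id : 'rV[R]_n -> 'rV[R]_n) x 'e_i by exact: derivable_id.
have := congr1 (fun v : 'rV[R]_n => v 0 j) (derive_mx dm).
by rewrite derive_id !mxE eqxx /= eq_sym => ->.
Qed.

Lemma smooth_coord U j : smooth_on U (fun x : 'rV[R]_n => x 0 j).
Proof.
apply/smooth_onP => -[|k].
  by move=> [|//] x _ _; exact: differentiable_coord.
apply/diff_uptoS; split=> [x _|i]; first exact: differentiable_coord.
rewrite (_ : partial i _ = fun=> (i == j)%:R); first exact: diff_upto_cst.
by apply/funext => x; exact: partial_coord.
Qed.

End Smooth.

(** * Chain rule and symmetry of second derivatives *)

Section Composition.
Variables (R : realType).

Lemma differentiable_coords (V : normedModType R) m (f : V -> 'rV[R]_m) x :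
  (forall j, differentiable (fun y => f y 0 j) x) -> differentiable f x.
Proof.
move=> df; rewrite (_ : f = \sum_j (fun y => f y 0 j *: 'e_j)).
  by apply: differentiable_sum => j; exact: differentiableZl.
by apply/funext => y; rewrite fct_sumE -row_sum_delta.
Qed.

Lemma derive_coord (V : normedModType R) m (f : V -> 'rV[R]_m) x v j :
  (forall j, differentiable (fun y => f y 0 j) x) ->
  ('D_v f x) 0 j = 'D_v (fun y => f y 0 j) x.
Proof.
move=> df; rewrite derive_mx ?mxE //.
by apply: diff_derivable; exact: differentiable_coords.
Qed.

Lemma partial_comp n m (f : 'rV[R]_m -> R) (phi : 'rV[R]_n -> 'rV[R]_m) i x :
  (forall j, differentiable (fun y => phi y 0 j) x) ->
  differentiable f (phi x) ->
  partial i (f \o phi) x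
  = \sum_j partial i (fun y => phi y 0 j) x * partial j f (phi x).
Proof.
move=> dphi df; have dphi' := differentiable_coords dphi.
rewrite {1}/partial deriveE; last exact: differentiable_comp.
rewrite diff_comp //= -(deriveE _ dphi') -(deriveE _ df) derive_partial //.
by apply: eq_bigr => j _; rewrite derive_coord.
Qed.

(** By the chain rule, a partial derivative of [f \o phi] is a sum of products
    of a smooth function and of a composite to which the induction applies. *)
Lemma smooth_comp n m (U : set 'rV[R]_n) (V : set 'rV[R]_m)
    (f : 'rV[R]_m -> R) (phi : 'rV[R]_n -> 'rV[R]_m) :
  open U -> (forall x, U x -> V (phi x)) ->
  smooth_on V f -> smooth_map_on U phi -> smooth_on U (f \o phi).
Proof.
move=> oU UV sf sphi; apply/smooth_onP => k; elim: k f sf => [|k IH] f sf.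
  move=> [|//] x _ Ux /=; apply: differentiable_comp.
    by apply: differentiable_coords => j; exact: smooth_diff (sphi j) Ux.
  by apply: smooth_diff sf _; exact: UV.
apply/diff_uptoS; split.
  move=> x Ux; apply: differentiable_comp.
    by apply: differentiable_coords => j; exact: smooth_diff (sphi j) Ux.
  by apply: smooth_diff sf _; exact: UV.
move=> i.
have : diff_upto k U (fun x => \sum_j
    partial i (fun y => phi y 0 j) x * partial j f (phi x)).
  elim: (index_enum _) => [|j r IHr].
    by under eq_fun do rewrite big_nil; exact: diff_upto_cst.
  under eq_fun do rewrite big_cons; apply: diff_uptoD => //.
  apply: diff_uptoM => //.
    by move/smooth_onP : (smooth_partial i (sphi j)); apply.
  by apply: IH; exact: smooth_partial.
apply: diff_upto_eq => // x Ux; rewrite partial_comp //.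
  by move=> j; exact: smooth_diff (sphi j) Ux.
by apply: smooth_diff sf _; exact: UV.
Qed.

Lemma is_derive_line (V : normedModType R) (f : V -> R) (y v : V) (s : R) :
  differentiable f (s *: v + y) ->
  is_derive s 1 (fun t : R => f (t *: v + y)) ('D_v f (s *: v + y)).
Proof.
move=> df; pose l := fun t : R => t *: v + y.
have dl : differentiable l s by [].
apply: DeriveDef; first by apply: diff_derivable; exact: differentiable_comp.
rewrite deriveE; last exact: differentiable_comp.
rewrite (diff_comp dl df) /= [RHS]deriveE //; congr ('d _ _ _).
rewrite -deriveE // /l deriveD //; last exact: diff_derivable.
rewrite derive_cst addr0 deriveE //.
have -> : (fun t : R => t *: v) = ( *:%R^~ v) by [].
by rewrite diff_val scale1r.
Qed.

(** The mean value theorem, applied in the direction [u] to the increment of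
    [f] along [v], and then in the direction [v] to the derivative of [f]
    along [u].  The left-hand side is symmetric in [u] and [v], which is what
    yields the symmetry of second derivatives. *)
Lemma double_MVT n (f : 'rV[R]_n -> R) (x : 'rV[R]_n) (u v : 'rV[R]_n) (h : R) :
  0 < h ->
  (forall s t, 0 <= s <= h -> 0 <= t <= h ->
     differentiable f (s *: u + (t *: v + x)) /\
     differentiable (fun y => 'D_u f y) (t *: v + (s *: u + x))) ->
  exists s t, [/\ 0 <= s <= h, 0 <= t <= h &
    f (h *: u + (h *: v + x)) - f (h *: u + x) - (f (h *: v + x) - f x)
    = h ^+ 2 * 'D_v (fun y => 'D_u f y) (t *: v + (s *: u + x))].
Proof.
move=> h0 df; have h0' := ltW h0.
have zh : 0 <= (0:R) <= h by rewrite lexx h0'.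
have hh : 0 <= h <= h by rewrite lexx h0'.
pose phi s := f (s *: u + (h *: v + x)) - f (s *: u + x).
pose dphi s := 'D_u f (s *: u + (h *: v + x)) - 'D_u f (s *: u + x).
have dphiP s : 0 <= s <= h -> is_derive s 1 phi (dphi s).
  move=> sh; apply: is_deriveB.
    by apply: is_derive_line; exact: (df s h sh hh).1.
  apply: is_derive_line.
  by have := (df s 0 sh zh).1; rewrite scale0r add0r.
have itvP' s : s \in `]0, h[%R -> 0 <= s <= h.
  by rewrite in_itv/= => /andP[/ltW -> /ltW ->].
have [||s sh Es] := @MVT R phi dphi 0 h h0.
- by move=> s /itvP'; exact: dphiP.
- apply: derivable_within_continuous => s; rewrite in_itv/= => sh.
  by have [] := dphiP s sh.
have {}sh := itvP' _ sh.
pose psi t := 'D_u f (t *: v + (s *: u + x)).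
pose dpsi t := 'D_v (fun y => 'D_u f y) (t *: v + (s *: u + x)).
have dpsiP t : 0 <= t <= h -> is_derive t 1 psi (dpsi t).
  move=> th; apply: (@is_derive_line _ (fun y => 'D_u f y)).
  exact: (df s t sh th).2.
have [||t th Et] := @MVT R psi dpsi 0 h h0.
- by move=> t /itvP'; exact: dpsiP.
- apply: derivable_within_continuous => t; rewrite in_itv/= => th.
  by have [] := dpsiP t th.
exists s, t; split=> //; first exact: itvP'.
move: Es Et; rewrite /phi /psi !scale0r !add0r !subr0 => -> Et.
rewrite expr2 -mulrA [h * 'D_v _ _]mulrC -Et mulrC /dphi.
by rewrite (addrCA (s *: u)).
Qed.

(** The same second difference, divided by [h ^+ 2], is a value of each of the
    two mixed derivatives near [x]; both are continuous at [x]. *)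
Lemma schwarz n (U : set 'rV[R]_n) (f : 'rV[R]_n -> R) i j x :
  open U -> smooth_on U f -> U x ->
  partial i (partial j f) x = partial j (partial i f) x.
Proof.
move=> oU sf Ux; apply/eqP; rewrite -subr_eq0 -normr_le0.
apply/ler_addgt0Pl => e e0; rewrite addr0.
have contP k l : {for x, continuous (partial k (partial l f))}.
  apply: differentiable_continuous; apply: smooth_diff (Ux).
  by do 2!apply: smooth_partial.
have e20 : 0 < e / 2 by rewrite divr_gt0.
have /nbhs_ballP[r r0 xr] : \forall y \near x, [/\ U y,
    `|partial i (partial j f) x - partial i (partial j f) y| < e / 2 &
    `|partial j (partial i f) x - partial j (partial i f) y| < e / 2].
  have /cvgrPdist_lt/(_ _ e20) := contP i j.
  have /cvgrPdist_lt/(_ _ e20) := contP j i.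
  have : \forall y \near x, U y by exact: open_nbhs_nbhs.
  by apply: filterS3 => y Uy Aji Aij; split; [exact: Uy|exact: Aij|exact: Aji].
(* With step r / M, the parallelogram spanned at x stays in the ball. *)
pose M : R := `|'e_i : 'rV[R]_n| + `|'e_j : 'rV[R]_n| + 1.
have M0 : 0 < M by rewrite ltr_wpDl // addr_ge0.
pose h := r / M.
have h0 : 0 < h by rewrite divr_gt0.
have near_x (k l : 'I_n) s t : `|'e_k : 'rV[R]_n| + `|'e_l : 'rV[R]_n| + 1 = M ->
    0 <= s <= h -> 0 <= t <= h -> ball x r (s *: 'e_k + (t *: 'e_l + x)).
  move=> kl /andP[s0 sh] /andP[t0 th]; rewrite -ball_normE /ball_ /=.
  rewrite distrC addrA addrK (le_lt_trans (ler_normD _ _)) // !normrZ.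
  rewrite (ger0_norm s0) (ger0_norm t0).
  apply: (@le_lt_trans _ _ (h * (M - 1))).
    by rewrite -kl addrK mulrDr lerD // ler_wpM2r.
  by rewrite mulrBr mulr1 divfK ?gt_eqF // ltrBlDr ltrDl.
have Mij : `|'e_j : 'rV[R]_n| + `|'e_i : 'rV[R]_n| + 1 = M.
  by rewrite /M (addrC `|'e_j|).
have dP k l (kl : `|'e_k : 'rV[R]_n| + `|'e_l : 'rV[R]_n| + 1 = M) s t :
    0 <= s <= h -> 0 <= t <= h ->
     differentiable f (s *: 'e_k + (t *: 'e_l + x)) /\
     differentiable (partial k f) (t *: 'e_l + (s *: 'e_k + x)).
  move=> sh th; have [Uy _ _] := xr _ (near_x _ _ _ _ kl sh th).
  split; first exact: smooth_diff Uy.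
  apply: smooth_diff (smooth_partial k sf) _.
  by rewrite addrA (addrC (t *: _)) -addrA.
have [s [t [sh th Est]]] := double_MVT h0 (dP _ _ Mij).
have [s' [t' [sh' th' Est']]] := double_MVT h0 (dP i j erefl).
have [_ A _] := xr _ (near_x i j _ _ erefl th sh).
have [_ _ B] := xr _ (near_x j i _ _ Mij th' sh').
have E : partial i (partial j f) (t *: 'e_i + (s *: 'e_j + x)) =
         partial j (partial i f) (t' *: 'e_j + (s' *: 'e_i + x)).
  apply: (mulfI (lt0r_neq0 (exprn_gt0 2 h0))); rewrite -[LHS]Est -[RHS]Est'.
  by rewrite addrCA; ring.
move: A B; rewrite E.
move: (partial i _ x) (partial j _ x) (partial j _ _) => a b c ac bc.
apply: (le_trans (ler_distD c a b)); rewrite [e]splitr; apply: lerD.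
  exact: ltW.
by rewrite distrC; exact: ltW.
Qed.

End Composition.

(** * Matrix-valued functions *)

Section MatrixPartial.
Variables (R : realType) (n : nat).
Implicit Types (U : set 'rV[R]_n) (x : 'rV[R]_n).

Definition mxdiff m p (A : 'rV[R]_n -> 'M[R]_(m, p)) x :=
  forall j k, differentiable (fun y => A y j k) x.

Definition mxsmooth m p U (A : 'rV[R]_n -> 'M[R]_(m, p)) :=
  forall j k, smooth_on U (fun y => A y j k).

(** Defined by entries, so that rows, transposes and rectangular products obey
    the same rules. *)
Definition mxpartial m p (i : 'I_n) (A : 'rV[R]_n -> 'M[R]_(m, p)) x : 'M[R]_(m, p) :=
  \matrix_(j, k) partial i (fun y => A y j k) x.

Lemma mxsmooth_diff m p U (A : 'rV[R]_n -> 'M[R]_(m, p)) x :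
  mxsmooth U A -> U x -> mxdiff A x.
Proof. by move=> sA Ux j k; exact: smooth_diff (sA j k) Ux. Qed.

Lemma mxsmooth_sub m p U U' (A : 'rV[R]_n -> 'M[R]_(m, p)) :
  U' `<=` U -> mxsmooth U A -> mxsmooth U' A.
Proof. by move=> UU sA j k; exact: smooth_on_sub (sA j k). Qed.

Lemma smooth_map_mx m U (f : 'rV[R]_n -> 'rV[R]_m) :
  smooth_map_on U f <-> mxsmooth U f.
Proof. by split=> [sf i j|sf j] //; rewrite ord1. Qed.

Lemma mxsmooth_eq m p U (A B : 'rV[R]_n -> 'M[R]_(m, p)) :
  open U -> (forall x, U x -> A x = B x) -> mxsmooth U A -> mxsmooth U B.
Proof.
by move=> oU AB sA j k; apply: smooth_on_eq (sA j k) => // x Ux; rewrite AB.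
Qed.

Lemma mxpartial_eq m p U (A B : 'rV[R]_n -> 'M[R]_(m, p)) i :
  open U -> (forall x, U x -> A x = B x) ->
  forall x, U x -> mxpartial i A x = mxpartial i B x.
Proof.
move=> oU AB x Ux; apply/matrixP => j k; rewrite !mxE.
by apply: (partial_eq_on i oU) => // y Uy; rewrite AB.
Qed.

Lemma mxpartial_cst m p i (A : 'M[R]_(m, p)) x : mxpartial i (fun=> A) x = 0.
Proof. by apply/matrixP => j k; rewrite !mxE partial_cst. Qed.

Lemma mxpartialD m p i (A B : 'rV[R]_n -> 'M[R]_(m, p)) x :
  mxdiff A x -> mxdiff B x ->
  mxpartial i (fun y => A y + B y) x = mxpartial i A x + mxpartial i B x.
Proof.
move=> dA dB; apply/matrixP => j k; rewrite !mxE -partialD //.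
by apply: eq_partial => y; rewrite mxE.
Qed.

Lemma mxpartialN m p i (A : 'rV[R]_n -> 'M[R]_(m, p)) x :
  mxdiff A x -> mxpartial i (fun y => - A y) x = - mxpartial i A x.
Proof.
move=> dA; apply/matrixP => j k; rewrite !mxE -partialN //.
by apply: eq_partial => y; rewrite mxE.
Qed.

Lemma mxpartialB m p i (A B : 'rV[R]_n -> 'M[R]_(m, p)) x :
  mxdiff A x -> mxdiff B x ->
  mxpartial i (fun y => A y - B y) x = mxpartial i A x - mxpartial i B x.
Proof.
move=> dA dB; apply/matrixP => j k; rewrite !mxE -partialB //.
by apply: eq_partial => y; rewrite !mxE.
Qed.

Lemma mxpartialZ m p i (f : 'rV[R]_n -> R) (A : 'rV[R]_n -> 'M[R]_(m, p)) x :
  differentiable f x -> mxdiff A x ->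
  mxpartial i (fun y => f y *: A y) x = partial i f x *: A x + f x *: mxpartial i A x.
Proof.
move=> df dA; apply/matrixP => j k; rewrite !mxE -partialM //.
by apply: eq_partial => y; rewrite !mxE.
Qed.

Lemma mxpartialM m p q i (A : 'rV[R]_n -> 'M[R]_(m, p))
    (B : 'rV[R]_n -> 'M[R]_(p, q)) x : mxdiff A x -> mxdiff B x ->
  mxpartial i (fun y => A y *m B y) x
  = mxpartial i A x *m B x + A x *m mxpartial i B x.
Proof.
move=> dA dB; apply/matrixP => j k; rewrite !mxE -big_split /=.
under [RHS]eq_bigr do rewrite !mxE -partialM //.
rewrite -partial_sum; last by move=> l; exact: differentiableM.
by apply: eq_partial => y; rewrite !mxE.
Qed.

Lemma mxpartial_tr m p i (A : 'rV[R]_n -> 'M[R]_(m, p)) x :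
  mxpartial i (fun y => (A y)^T) x = (mxpartial i A x)^T.
Proof.
apply/matrixP => j k; rewrite !mxE.
by apply: eq_partial => y; rewrite !mxE.
Qed.

Lemma mxsmooth_partial m p U (A : 'rV[R]_n -> 'M[R]_(m, p)) i :
  mxsmooth U A -> mxsmooth U (mxpartial i A).
Proof.
move=> sA j k; rewrite (_ : (fun y => _) = partial i (fun y => A y j k)).
  exact: smooth_partial.
by apply/funext => y; rewrite mxE.
Qed.

Lemma mxsmooth_cst m p U (A : 'M[R]_(m, p)) : mxsmooth U (fun=> A).
Proof. by move=> j k; exact: smooth_cst. Qed.

Lemma mxsmoothD m p U (A B : 'rV[R]_n -> 'M[R]_(m, p)) : open U ->
  mxsmooth U A -> mxsmooth U B -> mxsmooth U (fun x => A x + B x).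
Proof.
move=> oU sA sB j k; have := smoothD oU (sA j k) (sB j k).
by apply: smooth_on_eq => // x _; rewrite mxE.
Qed.

Lemma mxsmoothN m p U (A : 'rV[R]_n -> 'M[R]_(m, p)) : open U ->
  mxsmooth U A -> mxsmooth U (fun x => - A x).
Proof.
move=> oU sA j k; have := smoothN oU (sA j k).
by apply: smooth_on_eq => // x _; rewrite mxE.
Qed.

Lemma mxsmoothB m p U (A B : 'rV[R]_n -> 'M[R]_(m, p)) : open U ->
  mxsmooth U A -> mxsmooth U B -> mxsmooth U (fun x => A x - B x).
Proof. by move=> oU sA sB; apply: mxsmoothD => //; exact: mxsmoothN. Qed.

Lemma mxsmoothZ m p U (f : 'rV[R]_n -> R) (A : 'rV[R]_n -> 'M[R]_(m, p)) : open U ->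
  smooth_on U f -> mxsmooth U A -> mxsmooth U (fun x => f x *: A x).
Proof.
move=> oU sf sA j k; have := smoothM oU sf (sA j k).
by apply: smooth_on_eq => // x _; rewrite mxE.
Qed.

Lemma mxsmoothM m p q U (A : 'rV[R]_n -> 'M[R]_(m, p))
    (B : 'rV[R]_n -> 'M[R]_(p, q)) : open U ->
  mxsmooth U A -> mxsmooth U B -> mxsmooth U (fun x => A x *m B x).
Proof.
move=> oU sA sB j k.
have : smooth_on U (fun x => \sum_l A x j l * B x l k).
  by apply: smooth_sum => // l; exact: smoothM.
by apply: smooth_on_eq => // x _; rewrite mxE.
Qed.

Lemma mxsmooth_sum m p U (I : Type) (r : seq I)
    (A : I -> 'rV[R]_n -> 'M[R]_(m, p)) : open U ->
  (forall i, mxsmooth U (A i)) -> mxsmooth U (fun x => \sum_(i <- r) A i x).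
Proof.
move=> oU sA j k; have := smooth_sum r oU (fun i => sA i j k).
by apply: smooth_on_eq => // x _; rewrite summxE.
Qed.

Lemma mxsmooth_tr m p U (A : 'rV[R]_n -> 'M[R]_(m, p)) : open U ->
  mxsmooth U A -> mxsmooth U (fun x => (A x)^T).
Proof.
by move=> oU sA j k; apply: smooth_on_eq (sA k j) => // x _; rewrite mxE.
Qed.

Lemma mxpartial_sum m p (I : Type) (r : seq I)
    (A : I -> 'rV[R]_n -> 'M[R]_(m, p)) i x :
  (forall k, mxdiff (A k) x) ->
  mxpartial i (fun y => \sum_(k <- r) A k y) x = \sum_(k <- r) mxpartial i (A k) x.
Proof.
move=> dA; apply/matrixP => j k; rewrite !mxE summxE.
under [RHS]eq_bigr do rewrite mxE.
rewrite -partial_sum; last by move=> l; exact: dA.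
by apply: eq_partial => y; rewrite summxE.
Qed.

Lemma mxschwarz m p U (A : 'rV[R]_n -> 'M[R]_(m, p)) i j x :
  open U -> mxsmooth U A -> U x ->
  mxpartial i (mxpartial j A) x = mxpartial j (mxpartial i A) x.
Proof.
move=> oU sA Ux; apply/matrixP => k l; rewrite [LHS]mxE [RHS]mxE.
have E i' : (fun y => mxpartial i' A y k l) = partial i' (fun y => A y k l).
  by apply/funext => y; rewrite mxE.
by rewrite !E; exact: (@schwarz R n U _ i j x oU (sA k l) Ux).
Qed.

Lemma derive_mxpartial m (A : 'rV[R]_n -> 'rV[R]_m) x v : mxdiff A x ->
  'D_v A x = \sum_i v 0 i *: mxpartial i A x.
Proof.
move=> dA; apply/rowP => j; rewrite derive_coord // derive_partial // summxE.
by apply: eq_bigr => i _; rewrite !mxE.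
Qed.

Lemma jacobian_partial m (A : 'rV[R]_n -> 'rV[R]_m) x i j : mxdiff A x ->
  ('J A x) i j = partial i (fun y => A y 0 j) x.
Proof.
move=> dA; have dA' : differentiable A x by exact: differentiable_coords.
rewrite /partial -derive_coord // deriveEjacobian //.
by rewrite -rowE [RHS]mxE.
Qed.

End MatrixPartial.

(** * Vector fields in charts *)

Section Charts.
Variables (R : realType) (n : nat) (M : smoothManifold R n).
Implicit Types (U V : set M) (a b c : atlas M) (p : M) (X Y Z : vfield M).

Definition chart_image a U : set 'rV[R]_n :=
  [set x | ccod a x /\ U (chartV a x)].

Definition in_chart a X : 'rV[R]_n -> 'rV[R]_n := fun x => X (chartV a x) a.

Definition transition a b : 'rV[R]_n -> 'rV[R]_n := chart b \o chartV a.

Lemma chart_image_open a U : open U -> open (chart_image a U).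
Proof.
move=> oU; have := @chartV_continuous R n M a.
rewrite continuous_open_subspace; last exact: ccod_open.
by move/(continuous_inP _ (@ccod_open R n M a)); apply.
Qed.

Lemma chart_image_chart a U p : cdom a p -> U p -> chart_image a U (chart a p).
Proof. by move=> ap Up; split; [exact: chart_ccod|rewrite chartK]. Qed.

Lemma transition_mxsmooth a b : mxsmooth (chart_image a (cdom b)) (transition a b).
Proof. by apply/smooth_map_mx; exact: transition_smooth. Qed.

Lemma transition_mxdiff a b p : cdom a p -> cdom b p ->
  mxdiff (transition a b) (chart a p).
Proof.
move=> ap bp; apply: mxsmooth_diff (@transition_mxsmooth a b) _.
exact: chart_image_chart.
Qed.

Lemma transitionJE a b p i j : cdom a p -> cdom b p ->
  transitionJ a b p i j = partial i (fun x => transition a b x 0 j) (chart a p).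
Proof. by move=> ap bp; rewrite [LHS]jacobian_partial //; exact: transition_mxdiff. Qed.

Lemma transitionJ_id a p : cdom a p -> transitionJ a a p = 1%:M.
Proof.
move=> ap; apply/matrixP => i j; rewrite transitionJE // [RHS]mxE.
rewrite -(partial_coord i j (chart a p)).
apply: (partial_eq_on i (@ccod_open R n M a)); last exact: chart_ccod.
by move=> x ax; rewrite /transition /= chartVK.
Qed.

Lemma transitionJ_comp a b c p : cdom a p -> cdom b p -> cdom c p ->
  transitionJ a c p = transitionJ a b p *m transitionJ b c p.
Proof.
move=> ap bp cp; apply/matrixP => i k; rewrite transitionJE // [RHS]mxE.
have -> : partial i (fun x => transition a c x 0 k) (chart a p) =
    partial i ((fun y => transition b c y 0 k) \o transition a b) (chart a p).
  apply: (partial_eq_on i (chart_image_open (a := a) (@cdom_open R n M b))).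
    by move=> x [ax bx]; rewrite /transition /= chartK.
  exact: chart_image_chart.
have bE : transition a b (chart a p) = chart b p by rewrite /transition /= chartK.
rewrite partial_comp ?bE.
- by apply: eq_bigr => j _; congr (_ * _); apply: esym; exact: transitionJE.
- exact: (transition_mxdiff ap bp 0).
- exact: (transition_mxdiff bp cp 0).
Qed.

(** Smoothness on a set covered by the chart [a] may be tested in that chart
    alone. *)
Lemma smooth_transport a b U (f : 'rV[R]_n -> R) : open U -> U `<=` cdom a ->
  smooth_on (chart_image a U) f ->
  smooth_on (chart_image b U) (f \o transition b a).
Proof.
move=> oU Ua sf; apply: (@smooth_comp R n n _ (chart_image a U)) => //.
- exact: chart_image_open.
- move=> x [bx Ux]; apply: chart_image_chart => //; exact: Ua.
- move=> j; apply: smooth_on_sub (transition_smooth j) => x [bx Ux].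
  by split=> //; exact: Ua.
Qed.

Lemma smooth_vfield_mx U X a : smooth_vfield U X ->
  mxsmooth (chart_image a U) (in_chart a X).
Proof. by move=> [_ sX]; apply/smooth_map_mx; exact: sX. Qed.

Lemma smooth_vfield_sub U V X : V `<=` U -> smooth_vfield U X -> smooth_vfield V X.
Proof.
move=> VU [tX sX]; split=> [a b p /VU|a j]; first exact: tX.
by apply: smooth_on_sub (sX a j) => x [ax /VU].
Qed.

Lemma smooth_vfield_eq U X Y : open U -> agree_on U X Y ->
  smooth_vfield U X -> smooth_vfield U Y.
Proof.
move=> oU XY [tX sX]; split=> [a b p Up ap bp|a j].
  by rewrite -!XY //; exact: tX.
apply: smooth_on_eq (sX a j); first exact: chart_image_open.
by move=> x [ax Ux]; rewrite XY //; exact: chartV_cdom.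
Qed.

Lemma vadd_smooth U X Y : open U -> smooth_vfield U X -> smooth_vfield U Y ->
  smooth_vfield U (vadd X Y).
Proof.
move=> oU sX sY; split=> [a b p Up ap bp|a].
  by rewrite /vadd (vfield_transform sX Up ap bp) (vfield_transform sY Up ap bp) mulmxDl.
apply/smooth_map_mx; apply: mxsmoothD; first exact: chart_image_open.
  exact: smooth_vfield_mx.
exact: smooth_vfield_mx.
Qed.

Lemma vscale_smooth U (f : M -> R) X : open U -> smooth_fun U f ->
  smooth_vfield U X -> smooth_vfield U (vscale f X).
Proof.
move=> oU sf sX; split=> [a b p Up ap bp|a].
  by rewrite /vscale (vfield_transform sX Up ap bp) scalemxAl.
apply/smooth_map_mx; apply: mxsmoothZ; first exact: chart_image_open.
  exact: sf.
exact: smooth_vfield_mx.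
Qed.

Definition vzero : vfield M := fun _ _ => 0.

Lemma vzero_smooth U : smooth_vfield U vzero.
Proof.
split=> [a b p _ _ _|a]; first by rewrite mul0mx.
by apply/smooth_map_mx; exact: mxsmooth_cst.
Qed.

(** Combinations are indexed by lists because a connection is only known to be
    additive in two terms at a time. *)
Definition vcomb (r : seq 'I_n) (f : 'I_n -> M -> R) (E : 'I_n -> vfield M) : vfield M :=
  foldr (fun i => vadd (vscale (f i) (E i))) vzero r.

Lemma vcombE r f E p a : vcomb r f E p a = \sum_(i <- r) f i p *: E i p a.
Proof.
by elim: r => [|i r IH]; rewrite ?big_nil // big_cons -IH.
Qed.

Lemma vcomb_smooth U r f E : open U -> (forall i, smooth_fun U (f i)) ->
  (forall i, smooth_vfield U (E i)) -> smooth_vfield U (vcomb r f E).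
Proof.
move=> oU sf sE; elim: r => [|i r IH]; first exact: vzero_smooth.
by apply: vadd_smooth => //; exact: vscale_smooth.
Qed.

(** In the chart [b], the components of a coordinate field of [a] are first
    derivatives of the transition from [a] to [b], read through the transition
    from [b] to [a]. *)
Lemma coord_field_smooth a i : smooth_vfield (cdom a) (coord_field a i).
Proof.
split=> [b c p ap bp cp|b].
  by rewrite /coord_field (transitionJ_comp ap bp cp) row_mul.
move=> j; have : smooth_on (chart_image b (cdom a `&` cdom b))
    (partial i (fun x => transition a b x 0 j) \o transition b a).
  apply: smooth_transport; first by apply: openI; exact: cdom_open.
    by move=> p [].
  apply: smooth_partial; apply: smooth_on_sub (transition_smooth j).
  by move=> x [ax [_ bx]].
move=> /smooth_on_sub sub; apply: (smooth_on_eq _ _ (sub _ _)).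
- by apply: chart_image_open; exact: cdom_open.
- move=> x [bx ax]; rewrite /coord_field mxE transitionJE //.
  exact: chartV_cdom.
- by move=> x [bx ax]; split=> //; split=> //; exact: chartV_cdom.
Qed.

Lemma coord_field_chart a i p : cdom a p -> coord_field a i p a = 'e_i.
Proof. by move=> ap; rewrite /coord_field transitionJ_id // rowE mulmx1. Qed.

Lemma component_smooth a U X i : open U -> U `<=` cdom a -> smooth_vfield U X ->
  smooth_fun U (fun p => X p a 0 i).
Proof.
move=> oU Ua sX b.
have := smooth_transport (b := b) oU Ua (smooth_vfield_mx sX 0 i).
apply: smooth_on_eq; first exact: chart_image_open.
by move=> x [bx Ux]; rewrite /in_chart /transition /= chartK //; exact: Ua.
Qed.

Lemma vcomb_coord a U X : U `<=` cdom a -> smooth_vfield U X ->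
  agree_on U X
    (vcomb (index_enum 'I_n) (fun i p => X p a 0 i) (coord_field a)).
Proof.
move=> Ua sX p b Up bp; rewrite vcombE (vfield_transform sX Up (Ua _ Up) bp).
by rewrite mulmx_sum_row.
Qed.

End Charts.

(** * Connections in charts *)

Section Connections.
Variables (R : realType) (n : nat) (M : smoothManifold R n).
Variable nabla : connection M.
Implicit Types (U V : set M) (a b c : atlas M) (p : M) (X Y Z : vfield M).

(** Row [j] holds the components of the derivative of the [j]-th coordinate
    field along the [i]-th one, so that component rows act from the left. *)
Definition conn_mx a (i : 'I_n) : 'rV[R]_n -> 'M[R]_n :=
  fun x => \matrix_(j, k) conn_coef nabla a k j i (chartV a x).

Lemma row_conn_mx a i j p : cdom a p ->
  row j (conn_mx a i (chart a p)) = nabla (coord_field a i) (coord_field a j) p a.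
Proof. by move=> ap; apply/rowP => k; rewrite !mxE chartK. Qed.

Lemma conn_mx_smooth a i : mxsmooth (ccod a) (conn_mx a i).
Proof.
move=> j k; have sX := cov_smooth nabla (@cdom_open _ _ M a)
  (coord_field_smooth a i) (coord_field_smooth a j).
have := vfield_smooth sX => /(_ a k).
move/smooth_on_sub => sub; apply: (smooth_on_eq _ _ (sub _ _)).
- exact: ccod_open.
- by move=> x ax; rewrite mxE.
- by move=> x ax; split=> //; exact: chartV_cdom.
Qed.

Lemma cov_vcombl U r f E Y : open U -> (forall i, smooth_fun U (f i)) ->
  (forall i, smooth_vfield U (E i)) -> smooth_vfield U Y ->
  agree_on U (nabla (vcomb r f E) Y) (vcomb r f (fun i => nabla (E i) Y)).
Proof.
move=> oU sf sE sY; elim: r => [|i r IH] p a Up ap /=.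
  have E0 : vscale (fun=> 0) (@vzero R n M) = @vzero R n M.
    by apply/funext => q; apply/funext => b; exact: scale0r.
  have s0 : smooth_fun U (fun=> 0 : R) by move=> b; exact: smooth_cst.
  have := covZl nabla oU s0 (@vzero_smooth _ _ M U) sY Up ap.
  by rewrite E0 => ->; exact: scale0r.
rewrite (covDl nabla oU _ _ sY Up ap); last exact: vcomb_smooth.
  by rewrite /vadd (IH _ _ Up ap) (covZl nabla oU).
exact: vscale_smooth.
Qed.

Lemma cov_vcombr U r f E X p a : open U -> (forall i, smooth_fun U (f i)) ->
  (forall i, smooth_vfield U (E i)) -> smooth_vfield U X -> U p -> cdom a p ->
  nabla X (vcomb r f E) p a
  = \sum_(i <- r) (vderive a X (f i) p *: E i p a + f i p *: nabla X (E i) p a).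
Proof.
move=> oU sf sE sX Up ap; elim: r => [|i r IH] /=.
  have E0 : vscale (fun=> 0) (@vzero R n M) = @vzero R n M.
    by apply/funext => q; apply/funext => b; exact: scale0r.
  have s0 : smooth_fun U (fun=> 0 : R) by move=> b; exact: smooth_cst.
  have := cov_leibniz nabla oU s0 sX (@vzero_smooth _ _ M U) Up ap.
  by rewrite E0 big_nil => ->; rewrite scaler0 scale0r addr0.
rewrite (covDr nabla oU sX _ _ Up ap); last exact: vcomb_smooth.
  by rewrite /vadd IH big_cons (cov_leibniz nabla oU).
exact: vscale_smooth.
Qed.

(** The component row of the covariant derivative of [Z] along the [i]-th
    coordinate field. *)
Definition covd (G : 'I_n -> 'rV[R]_n -> 'M[R]_n) i (Z : 'rV[R]_n -> 'rV[R]_n) x :=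
  mxpartial i Z x + Z x *m G i x.

(** On the part of [U] covered by the chart, both fields are combinations of
    coordinate fields with smooth coefficients, and by [cov_local] they may be
    replaced by these combinations. *)
Lemma cov_in_chart U X Y a p : open U -> smooth_vfield U X -> smooth_vfield U Y ->
  U p -> cdom a p ->
  nabla X Y p a
  = \sum_i X p a 0 i *: covd (conn_mx a) i (in_chart a Y) (chart a p).
Proof.
move=> oU sX sY Up ap; pose V := U `&` cdom a.
have oV : open V by apply: openI => //; exact: cdom_open.
have VU : V `<=` U by move=> q [].
have Va : V `<=` cdom a by move=> q [].
have {sX} sX := smooth_vfield_sub VU sX.
have {sY} sY := smooth_vfield_sub VU sY.
have sE i := smooth_vfield_sub Va (coord_field_smooth a i).
have Vp : V p by [].
have sXi i := component_smooth i oV Va sX.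
have sYi i := component_smooth i oV Va sY.
have sX' := vcomb_smooth (index_enum _) oV sXi sE.
have sY' := vcomb_smooth (index_enum _) oV sYi sE.
rewrite (cov_local nabla oV sX sX' sY sY' (vcomb_coord Va sX) (vcomb_coord Va sY) Vp ap).
rewrite (cov_vcombl _ oV sXi sE sY' Vp ap) vcombE; apply: eq_bigr => i _.
rewrite (cov_vcombr _ oV sYi sE (sE i) Vp ap) big_split /=.
congr (_ *: (_ + _)).
  rewrite [RHS]row_sum_delta; apply: eq_bigr => j _.
  by rewrite /vderive !coord_field_chart // mxE.
rewrite mulmx_sum_row /in_chart chartK //; apply: eq_bigr => j _.
by rewrite row_conn_mx.
Qed.

End Connections.

(** * Curvature in charts *)

(** Turns an identity between expanded matrix expressions into one that is
    linear in opaque matrices, so that it can be checked by entries. *)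
Ltac mx_generalize :=
  repeat match goal with
  | |- context [mulmx ?A ?B] => let C := fresh "C" in set C := mulmx A B; clearbody C
  end;
  repeat match goal with
  | |- context [trmx ?A] => let C := fresh "C" in set C := trmx A; clearbody C
  | |- context [mxpartial ?i ?A ?x] =>
    let C := fresh "C" in set C := mxpartial i A x; clearbody C
  end.

Section Curvature.
Variables (R : realType) (n : nat).

(** Since rows act from the left, the two products come in the order opposite
    to that of the composition of operators. *)
Definition curv_mx (G : 'I_n -> 'rV[R]_n -> 'M[R]_n) (i j : 'I_n) x : 'M[R]_n :=
  mxpartial i (G j) x - mxpartial j (G i) x + G j x *m G i x - G i x *m G j x.

Lemma covd_smooth W (G : 'I_n -> 'rV[R]_n -> 'M[R]_n) Z i : open W ->
  (forall i, mxsmooth W (G i)) -> mxsmooth W Z -> mxsmooth W (covd G i Z).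
Proof.
move=> oW sG sZ; apply: mxsmoothD => //; first exact: mxsmooth_partial.
exact: mxsmoothM.
Qed.

Lemma covd_covd W (G : 'I_n -> 'rV[R]_n -> 'M[R]_n) Z i j x : open W -> W x ->
  (forall i, mxsmooth W (G i)) -> mxsmooth W Z ->
  covd G i (covd G j Z) x
  = mxpartial i (mxpartial j Z) x + mxpartial i Z x *m G j x
    + Z x *m mxpartial i (G j) x + (mxpartial j Z x + Z x *m G j x) *m G i x.
Proof.
move=> oW Wx sG sZ; have dZ := mxsmooth_diff sZ Wx.
have dG := mxsmooth_diff (sG j) Wx.
rewrite {1}/covd; congr (_ + _); rewrite /covd mxpartialD ?mxpartialM ?addrA //.
- exact: (mxsmooth_diff (mxsmooth_partial j sZ) Wx).
- exact: (mxsmooth_diff (mxsmoothM oW sZ (sG j)) Wx).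
Qed.

(** The second derivatives of [Z] cancel by symmetry, and the first ones
    because they occur symmetrically in [i] and [j]. *)
Lemma covd_commutator W (G : 'I_n -> 'rV[R]_n -> 'M[R]_n) Z i j x : open W -> W x ->
  (forall i, mxsmooth W (G i)) -> mxsmooth W Z ->
  covd G i (covd G j Z) x - covd G j (covd G i Z) x = Z x *m curv_mx G i j x.
Proof.
move=> oW Wx sG sZ; rewrite !(covd_covd _ _ oW Wx sG sZ).
rewrite (mxschwarz i j oW sZ Wx) /curv_mx !mulmxDl !mulmxDr !mulmxN !mulmxA.
by mx_generalize; apply/rowP => k; rewrite !mxE; ring.
Qed.

Lemma covd_comb W (G : 'I_n -> 'rV[R]_n -> 'M[R]_n) (Y : 'rV[R]_n -> 'rV[R]_n)
    (C : 'I_n -> 'rV[R]_n -> 'rV[R]_n) i x : open W -> W x ->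
  mxsmooth W Y -> (forall j, mxsmooth W (C j)) ->
  covd G i (fun y => \sum_j Y y 0 j *: C j y) x
  = \sum_j (mxpartial i Y x 0 j *: C j x + Y x 0 j *: covd G i (C j) x).
Proof.
move=> oW Wx sY sC; rewrite /covd mxpartial_sum; last first.
  move=> k; exact: (mxsmooth_diff (mxsmoothZ oW (sY 0 k) (sC k)) Wx).
rewrite mulmx_suml -big_split /=; apply: eq_bigr => j _.
rewrite mxpartialZ; last exact: mxsmooth_diff (sC j) Wx.
  by rewrite scalerDr addrA scalemxAl mxE.
exact: smooth_diff (sY 0 j) Wx.
Qed.

(** Tensoriality: the derivatives of the components of [X] and [Y] are exactly
    those that make up the bracket. *)
Lemma commutator_in_coordinates W (G : 'I_n -> 'rV[R]_n -> 'M[R]_n)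
    (X Y Z : 'rV[R]_n -> 'rV[R]_n) x :
  open W -> W x -> (forall i, mxsmooth W (G i)) ->
  mxsmooth W X -> mxsmooth W Y -> mxsmooth W Z ->
  (\sum_i X x 0 i *: covd G i (fun y => \sum_j Y y 0 j *: covd G j Z y) x)
  - (\sum_i Y x 0 i *: covd G i (fun y => \sum_j X y 0 j *: covd G j Z y) x)
  - (\sum_j ('D_(X x) Y x - 'D_(Y x) X x) 0 j *: covd G j Z x)
  = \sum_i \sum_j (X x 0 i * Y x 0 j) *: (Z x *m curv_mx G i j x).
Proof.
move=> oW Wx sG sX sY sZ.
have sC j := covd_smooth (Z := Z) j oW sG sZ.
have E (A B : 'rV[R]_n -> 'rV[R]_n) : mxsmooth W A -> mxsmooth W B ->
    \sum_i A x 0 i *: covd G i (fun y => \sum_j B y 0 j *: covd G j Z y) x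
    = \sum_j ('D_(A x) B x) 0 j *: covd G j Z x
      + \sum_i \sum_j (A x 0 i * B x 0 j) *: covd G i (covd G j Z) x.
  move=> sA sB.
  rewrite (derive_mxpartial _ (mxsmooth_diff sB Wx)).
  under [X in X + _]eq_bigr do rewrite summxE scaler_suml.
  rewrite exchange_big /= -big_split /=; apply: eq_bigr => i _.
  rewrite (covd_comb _ _ oW Wx sB sC) scaler_sumr -big_split /=.
  by apply: eq_bigr => j _; rewrite scalerDr !scalerA [in RHS]mxE.
rewrite (E X Y sX sY) (E Y X sY sX).
have grp (A B C D : 'rV[R]_n) : A + C - (B + D) - (A - B) = C - D.
  by rewrite opprD addrACA [A - B + _]addrC addrK.
have -> : \sum_j ('D_(X x) Y x - 'D_(Y x) X x) 0 j *: covd G j Z x =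
    \sum_j ('D_(X x) Y x) 0 j *: covd G j Z x -
    \sum_j ('D_(Y x) X x) 0 j *: covd G j Z x.
  rewrite -sumrB; apply: eq_bigr => j _; rewrite -scalerBl; congr (_ *: _).
  by rewrite !mxE.
have -> : \sum_i \sum_j (X x 0 i * Y x 0 j) *: (Z x *m curv_mx G i j x) =
    \sum_i \sum_j (X x 0 i * Y x 0 j) *: covd G i (covd G j Z) x -
    \sum_i \sum_j (Y x 0 i * X x 0 j) *: covd G i (covd G j Z) x.
  rewrite [X in _ - X]exchange_big /= -sumrB; apply: eq_bigr => i _.
  rewrite -sumrB; apply: eq_bigr => j _.
  by rewrite [Y x 0 j * _]mulrC -scalerBr (covd_commutator _ _ oW Wx sG sZ).
exact: grp.
Qed.

End Curvature.

Section ManifoldCurvature.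
Variables (R : realType) (n : nat) (M : smoothManifold R n).
Implicit Types (U V : set M) (a b c : atlas M) (p : M) (X Y Z : vfield M).

Lemma conn_mx_smooth_image (nabla : connection M) a U i :
  mxsmooth (chart_image a U) (conn_mx nabla a i).
Proof.
by apply: mxsmooth_sub (@conn_mx_smooth _ _ _ nabla a i) => x [].
Qed.

Lemma curvature_in_chart (nabla : connection M) U X Y Z a p : open U ->
  smooth_vfield U X -> smooth_vfield U Y -> smooth_vfield U Z ->
  smooth_vfield U (lie_bracket X Y) -> U p -> cdom a p ->
  curvature nabla X Y Z p a
  = \sum_i \sum_j (X p a 0 i * Y p a 0 j) *:
      (Z p a *m curv_mx (conn_mx nabla a) i j (chart a p)).
Proof.
move=> oU sX sY sZ sL Up ap; pose W := chart_image a U.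
have oW : open W by exact: chart_image_open.
have Wx : W (chart a p) by exact: chart_image_chart.
have sG i := @conn_mx_smooth_image nabla a U i.
have chartE T : in_chart a T (chart a p) = T p a by rewrite /in_chart chartK.
have covE T : smooth_vfield U T -> forall y, W y -> in_chart a (nabla T Z) y
    = \sum_j in_chart a T y 0 j *: covd (conn_mx nabla a) j (in_chart a Z) y.
  move=> sV y [ay Uy].
  rewrite [LHS](cov_in_chart nabla oU sV sZ Uy (chartV_cdom ay)).
  by rewrite chartVK.
have covdE T : smooth_vfield U T -> forall i,
    covd (conn_mx nabla a) i (in_chart a (nabla T Z)) (chart a p)
    = covd (conn_mx nabla a) i (fun y => \sum_j in_chart a T y 0 j *:
        covd (conn_mx nabla a) j (in_chart a Z) y) (chart a p).
  move=> sV i; rewrite /covd (mxpartial_eq i oW (covE T sV) Wx).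
  by rewrite (covE T sV _ Wx).
rewrite /curvature.
rewrite (cov_in_chart nabla oU sX (cov_smooth nabla oU sY sZ) Up ap).
rewrite (cov_in_chart nabla oU sY (cov_smooth nabla oU sX sZ) Up ap).
rewrite (cov_in_chart nabla oU sL sZ Up ap).
under eq_bigr do rewrite (covdE Y sY).
under [X in _ - X - _]eq_bigr do rewrite (covdE X sX).
have := commutator_in_coordinates oW Wx sG (smooth_vfield_mx sX)
  (smooth_vfield_mx sY) (smooth_vfield_mx sZ).
by rewrite !chartE.
Qed.

End ManifoldCurvature.

(** * Metric connections with metric torsion dual *)

Section MetricAlgebra.
Variables (R : realType) (n : nat) (W : set 'rV[R]_n).
Hypothesis oW : open W.
Implicit Types (G : 'I_n -> 'rV[R]_n -> 'M[R]_n) (gam : 'rV[R]_n -> 'M[R]_n).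

(** The equation [nabla g = 0] for coordinate fields. *)
Definition metric_conn G gam := forall k x, W x ->
  mxpartial k gam x = G k x *m gam x + gam x *m (G k x)^T.

(** Differentiating the metric equation once more expresses the second
    derivatives of the metric; their symmetry is the skewness of curvature. *)
Lemma curv_mx_metric G gam k l x :
  (forall i, mxsmooth W (G i)) -> mxsmooth W gam -> metric_conn G gam -> W x ->
  curv_mx G k l x *m gam x + gam x *m (curv_mx G k l x)^T = 0.
Proof.
move=> sG sg mG Wx.
have dG i := mxsmooth_diff (sG i) Wx.
have dg := mxsmooth_diff sg Wx.
have E i j : mxpartial i (mxpartial j gam) x =
    mxpartial i (G j) x *m gam x
    + G j x *m (G i x *m gam x + gam x *m (G i x)^T)
    + ((G i x *m gam x + gam x *m (G i x)^T) *m (G j x)^T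
    + gam x *m (mxpartial i (G j) x)^T).
  rewrite (mxpartial_eq i oW (mG j) Wx) mxpartialD.
  - rewrite mxpartialM // mxpartialM // ?mG // ?mxpartial_tr //.
    by move=> r s; apply: (mxsmooth_diff (mxsmooth_tr oW (sG j)) Wx).
  - exact: (mxsmooth_diff (mxsmoothM oW (sG j) sg) Wx).
  - exact: (mxsmooth_diff (mxsmoothM oW sg (mxsmooth_tr oW (sG j))) Wx).
have := mxschwarz k l oW sg Wx; rewrite !E {E} => /eqP.
rewrite -subr_eq0 => /eqP <-.
rewrite /curv_mx !raddfD /= !raddfN /= !trmx_mul.
rewrite !(mulmxDl, mulmxDr, mulNmx, mulmxN, mulmxA).
by mx_generalize; apply/matrixP => r s; rewrite !mxE; ring.
Qed.

Variables (G Gs G0 : 'I_n -> 'rV[R]_n -> 'M[R]_n) (gam : 'rV[R]_n -> 'M[R]_n).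
Hypothesis sG : forall i, mxsmooth W (G i).
Hypothesis sGs : forall i, mxsmooth W (Gs i).
Hypothesis sG0 : forall i, mxsmooth W (G0 i).
Hypothesis sgam : mxsmooth W gam.
Hypothesis gam_sym : forall x, W x -> (gam x)^T = gam x.
Hypothesis gam_unit : forall x, W x -> gam x \in unitmx.
Hypothesis mG : metric_conn G gam.
Hypothesis mGs : metric_conn Gs gam.
Hypothesis mG0 : metric_conn G0 gam.
Hypothesis dualG : forall k j m x, W x -> Gs k x j m = G j x k m.
Hypothesis symG0 : forall k j m x, W x -> G0 k x j m = G0 j x k m.

(** The entry [(j, i)] is the lowered distortion N_ijk. *)
Definition dist_mx k x := (G k x - G0 k x) *m gam x.

Lemma diff_metric_skew G1 k x : metric_conn G1 gam -> W x ->
  ((G1 k x - G0 k x) *m gam x)^T = - ((G1 k x - G0 k x) *m gam x).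
Proof.
move=> mG1 Wx; have := mG1 k x Wx; rewrite mG0 // => /eqP; rewrite eq_sym -subr_eq0 => E.
apply/eqP; rewrite -addr_eq0 -(eqP E) trmx_mul gam_sym // raddfB /= mulmxBl mulmxBr.
by apply/eqP; mx_generalize; apply/matrixP => r s; rewrite !mxE; ring.
Qed.

(** The distortion is skew in its first two lowered indices, and the dual one,
    which exchanges the last two, is so too.  Two such transpositions generate
    all permutations, so the distortion is totally skew and its dual is its
    opposite. *)
Lemma torsion_dual_distortion k x : W x -> Gs k x = G0 k x - (G k x - G0 k x).
Proof.
move=> Wx; pose T := dist_mx; pose Ts j := (Gs j x - G0 j x) *m gam x.
have skT j r s : T j x r s = - T j x s r.
  by have /matrixP/(_ s r) := diff_metric_skew j mG Wx; rewrite !mxE.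
have skTs j r s : Ts j r s = - Ts j s r.
  by have /matrixP/(_ s r) := diff_metric_skew j mGs Wx; rewrite !mxE.
have TsT j r s : Ts j r s = T r x j s.
  rewrite /Ts /T /dist_mx !mxE; apply: eq_bigr => m _.
  by rewrite !mxE dualG // (symG0 j).
have : (Gs k x - G0 k x) *m gam x = - (G k x - G0 k x) *m gam x.
  rewrite mulNmx; apply/matrixP => r s; rewrite [RHS]mxE.
  change (Ts k r s = - T k x r s).
  by rewrite TsT skT -TsT skTs opprK TsT; exact: skT.
move=> /(can_inj (mulmxK (gam_unit Wx))) /eqP.
by rewrite subr_eq addrC => /eqP.
Qed.

(** The entry [(j, i)] is the Levi-Civita derivative of N_ijl along d_k, up to
    the term in which the coefficients act on the index [l]; that term is
    symmetric in [k] and [l], hence cancels in the alternated derivative. *)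
Definition cov_dist k l x := mxpartial k (dist_mx l) x
  - dist_mx l x *m (G0 k x)^T - G0 k x *m dist_mx l x.

(** Writing the two connections as [G0 + N] and [G0 - N], only the terms that
    are odd in N survive in the difference of the curvatures, which is the
    left-hand side because the dual curvature is skew. *)
Lemma curv_mx_dual k l x : W x ->
  curv_mx G k l x *m gam x + (curv_mx Gs k l x *m gam x)^T
  = 2 *: (cov_dist k l x - cov_dist l k x).
Proof.
move=> Wx.
have -> : (curv_mx Gs k l x *m gam x)^T = - (curv_mx Gs k l x *m gam x).
  apply/eqP; rewrite -addr_eq0 trmx_mul gam_sym // addrC; apply/eqP.
  exact: curv_mx_metric.
have dG i := mxsmooth_diff (sG i) Wx.
have dG0 i := mxsmooth_diff (sG0 i) Wx.
have dg := mxsmooth_diff sgam Wx.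
have dN i := mxsmooth_diff (mxsmoothB oW (sG i) (sG0 i)) Wx.
have dGs i j : mxpartial i (Gs j) x =
    mxpartial i (G0 j) x - (mxpartial i (G j) x - mxpartial i (G0 j) x).
  rewrite (mxpartial_eq i oW (torsion_dual_distortion j) Wx).
  by rewrite mxpartialB // mxpartialB.
have dT i j : mxpartial i (dist_mx j) x =
    (mxpartial i (G j) x - mxpartial i (G0 j) x) *m gam x
    + (G j x - G0 j x) *m (G0 i x *m gam x + gam x *m (G0 i x)^T).
  by rewrite /dist_mx mxpartialM // mxpartialB // mG0.
rewrite /cov_dist !dT /dist_mx /curv_mx !dGs !(torsion_dual_distortion _ Wx).
rewrite !(mulmxDl, mulmxDr, mulNmx, mulmxN, mulmxA).
by mx_generalize; apply/matrixP => r s; rewrite !mxE; ring.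
Qed.

End MetricAlgebra.

(** * The curvature identity on a manifold *)

Section CoordinateFields.
Variables (R : realType) (n : nat) (M : smoothManifold R n).
Implicit Types (U V : set M) (a b c : atlas M) (p : M) (X Y Z : vfield M).

Lemma lie_bracket_coord a i j p : cdom a p ->
  lie_bracket (coord_field a i) (coord_field a j) p a = 0.
Proof.
move=> ap; have D0 v k : 'D_v (fun x => coord_field a k (chartV a x) a) (chart a p) = 0.
  rewrite -(derive_cst ('e_k : 'rV[R]_n) (chart a p) v).
  apply: near_eq_derive; apply: (open_near (@ccod_open R n M a)).
    exact: chart_ccod.
  by move=> x ax; rewrite coord_field_chart //; exact: chartV_cdom.
by rewrite /lie_bracket !D0 subr0.
Qed.

Lemma torsion_dual_conn_mx (nabla nablas : connection M) a k j m x :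
  torsion_dual nabla nablas -> ccod a x ->
  conn_mx nablas a k x j m = conn_mx nabla a j x k m.
Proof.
move=> td ax; have ap := chartV_cdom ax.
have /rowP/(_ m) := td _ _ _ (@cdom_open _ _ M a) (coord_field_smooth a j)
  (coord_field_smooth a k) _ a ap ap.
rewrite (lie_bracket_coord _ _ ap) subr0 !mxE => /eqP.
by rewrite subr_eq0 => /eqP/esym.
Qed.

(** The bracket is a difference of covariant derivatives, which spares a
    computation of its change of coordinates. *)
Lemma lie_bracket_smooth (nabla nablas : connection M) U X Y :
  torsion_dual nabla nablas -> open U -> smooth_vfield U X -> smooth_vfield U Y ->
  smooth_vfield U (lie_bracket X Y).
Proof.
move=> td oU sX sY.
have sm1 : smooth_fun U (fun=> -1 : R) by move=> a; exact: smooth_cst.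
have := vadd_smooth oU (cov_smooth nabla oU sX sY)
  (vscale_smooth oU sm1 (cov_smooth nablas oU sY sX)).
apply: smooth_vfield_eq => // p a Up ap.
have /eqP := td _ _ _ oU sX sY p a Up ap.
by rewrite subr_eq0 /vadd /vscale scaleN1r => /eqP.
Qed.

(** Granted by any pair of torsion dual connections; stated apart because the
    criterion of flatness is applied to either member of the pair. *)
Definition smooth_brackets := forall U X Y, open U ->
  smooth_vfield U X -> smooth_vfield U Y -> smooth_vfield U (lie_bracket X Y).

Lemma curv_coefE (nabla : connection M) a m k i j p : smooth_brackets -> cdom a p ->
  curv_coef nabla a m k i j p = curv_mx (conn_mx nabla a) i j (chart a p) k m.
Proof.
move=> sb ap; have sE i' := coord_field_smooth a i'.
rewrite /curv_coef (curvature_in_chart nabla (@cdom_open _ _ M a) (sE i) (sE j)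
  (sE k) (sb _ _ _ (@cdom_open _ _ M a) (sE i) (sE j)) ap ap).
rewrite !coord_field_chart // (bigD1 i) //= [X in _ + X]big1 ?addr0; last first.
  move=> i' ii'; rewrite big1 // => j' _.
  by rewrite [X in X * _]mxE (negPf ii') andbF mul0r scale0r.
rewrite (bigD1 j) //= [X in _ + X]big1 ?addr0; last first.
  move=> j' jj'.
  by rewrite [X in _ * X]mxE (negPf jj') andbF mulr0 scale0r.
by rewrite [X in X * _]mxE [X in _ * X]mxE !eqxx /= mulr1 scale1r -rowE [LHS]mxE.
Qed.

Lemma flatP (nabla : connection M) : smooth_brackets ->
  flat nabla <-> forall a x i j, ccod a x -> curv_mx (conn_mx nabla a) i j x = 0.
Proof.
move=> sb; split=> [fl a x i j ax|K0 U X Y Z oU sX sY sZ p a Up ap].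
  have ap := chartV_cdom ax; rewrite -(chartVK ax).
  apply/matrixP => k m; rewrite -curv_coefE // [RHS]mxE /curv_coef.
  have sE i' := coord_field_smooth a i'.
  by rewrite (fl _ _ _ _ (@cdom_open _ _ M a) (sE i) (sE j) (sE k) _ a ap ap) mxE.
rewrite (curvature_in_chart nabla oU sX sY sZ (sb _ _ _ oU sX sY) Up ap).
rewrite big1 // => i _; rewrite big1 // => j _.
by rewrite K0 ?mulmx0 ?scaler0 //; exact: chart_ccod.
Qed.

End CoordinateFields.

Section MetricInChart.
Variables (R : realType) (n : nat) (M : smoothManifold R n) (g : riemannianMetric M).
Implicit Types (a : atlas M) (p : M).

Definition gram_mx a : 'rV[R]_n -> 'M[R]_n := fun x => g (chartV a x) a.

Lemma posdef_unitmx m (A : 'M[R]_m) :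
  (forall v : 'rV[R]_m, v != 0 -> 0 < (v *m A *m v^T) 0 0) -> A \in unitmx.
Proof.
move=> pos; rewrite -row_free_unit -kermx_eq0; apply/eqP/row_matrixP => i.
rewrite row0; apply/eqP; apply: contraT => /pos.
by rewrite -row_mul mulmx_ker row0 mul0mx mxE ltxx.
Qed.

Lemma gram_mx_unit a x : ccod a x -> gram_mx a x \in unitmx.
Proof.
by move=> ax; apply: posdef_unitmx => v; exact: gram_posdef (chartV_cdom ax) v.
Qed.

Lemma gram_mx_sym a x : ccod a x -> (gram_mx a x)^T = gram_mx a x.
Proof. by move=> ax; exact: gram_sym (chartV_cdom ax). Qed.

Lemma gram_mx_smooth a : mxsmooth (ccod a) (gram_mx a).
Proof. by move=> i j; exact: gram_smooth. Qed.

Lemma metric_conn_in_chart (nabla : connection M) a : is_metric g nabla ->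
  metric_conn (ccod a) (conn_mx nabla a) (gram_mx a).
Proof.
move=> mn k x ax; have ap := chartV_cdom ax.
have sE i := coord_field_smooth a i.
apply/matrixP => i j.
have := mn _ _ _ _ (@cdom_open _ _ M a) (sE k) (sE i) (sE j) _ a ap ap.
have rowG i' : nabla (coord_field a k) (coord_field a i') (chartV a x) a
    = row i' (conn_mx nabla a k x).
  by rewrite -{2}(chartVK ax) row_conn_mx.
have -> : cov_metric nabla g a (coord_field a k) (coord_field a i) (coord_field a j)
    (chartV a x) = partial k (fun y => gram_mx a y i j) x
    - (conn_mx nabla a k x *m gram_mx a x) i j
    - (gram_mx a x *m (conn_mx nabla a k x)^T) i j.
  rewrite /cov_metric /vderive coord_field_chart // chartVK //; congr (_ - _ - _).
  - apply: (partial_eq_on k (@ccod_open R n M a)) => // y ay /=.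
    have ay' := chartV_cdom ay.
    by rewrite /inner !coord_field_chart // -rowE trmx_delta -colE !mxE.
  - rewrite /inner rowG coord_field_chart // -row_mul trmx_delta -colE.
    by rewrite [LHS]mxE [LHS]mxE.
  - rewrite /inner rowG coord_field_chart // -rowE.
    by rewrite [LHS]mxE [RHS]mxE; apply: eq_bigr => m _; rewrite !mxE.
by move=> /eqP; rewrite subr_eq0 subr_eq => /eqP E; rewrite mxE E [RHS]mxE addrC.
Qed.

End MetricInChart.

Section TorsionDualMetric.
Variables (R : realType) (n : nat) (M : smoothManifold R n) (g : riemannianMetric M).
Variables (nabla nablas nabla0 : connection M).
Hypothesis td : torsion_dual nabla nablas.
Hypothesis mn : is_metric g nabla.
Hypothesis mns : is_metric g nablas.
Hypothesis lc : levi_civita g nabla0.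
Implicit Types (a : atlas M) (p : M).

Lemma curv_lowE (D : connection M) a i j k l p : smooth_brackets M -> cdom a p ->
  curv_low g D a i j k l p
  = (curv_mx (conn_mx D a) k l (chart a p) *m gram_mx g a (chart a p)) j i.
Proof.
move=> sb ap; rewrite /curv_low [RHS]mxE; apply: eq_bigr => m _.
rewrite curv_coefE // mulrC; congr (_ * _).
by rewrite /gram_mx chartK // -[in LHS](gram_sym g ap) mxE.
Qed.

Lemma distortion_lowE (D0 D : connection M) a i j k x : ccod a x ->
  distortion_low g D0 D a i j k (chartV a x)
  = dist_mx (conn_mx D a) (conn_mx D0 a) (gram_mx g a) k x j i.
Proof.
move=> ax; have ap := chartV_cdom ax; rewrite /distortion_low [RHS]mxE.
apply: eq_bigr => m _; rewrite mulrC !mxE; congr (_ * _).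
by rewrite /gram_mx -[in LHS](gram_sym g ap) mxE.
Qed.

Lemma skew_cov_distortionE a i j k l p : cdom a p ->
  4 * skew_cov_distortion g nabla0 nabla a i j k l p
  = (2 *: (cov_dist (conn_mx nabla a) (conn_mx nabla0 a) (gram_mx g a) k l (chart a p)
     - cov_dist (conn_mx nabla a) (conn_mx nabla0 a) (gram_mx g a) l k (chart a p))) j i.
Proof.
move=> ap; have ax := chart_ccod ap.
set T := dist_mx (conn_mx nabla a) (conn_mx nabla0 a) (gram_mx g a).
set G0 := conn_mx nabla0 a.
have G0E m j' k' : conn_coef nabla0 a m j' k' p = G0 k' (chart a p) j' m.
  by rewrite mxE chartK.
have TE i' j' k' : distortion_low g nabla0 nabla a i' j' k' p = T k' (chart a p) j' i'.
  by rewrite -distortion_lowE // chartK.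
have covE k' l' : cov_deriv3 nabla0 a (distortion_low g nabla0 nabla a) k' i j l' p
    = cov_dist (conn_mx nabla a) G0 (gram_mx g a) k' l' (chart a p) j i
      - \sum_m G0 k' (chart a p) l' m * T m (chart a p) j i.
  rewrite /cov_deriv3; under eq_bigr do rewrite !G0E !TE.
  have subE (A B C : 'M[R]_n) : (A - B - C) j i = A j i - B j i - C j i.
    by rewrite !mxE.
  rewrite !big_split /= /cov_dist subE [mxpartial _ _ _ _ _]mxE.
  have -> : 'D_'e_k' (distortion_low g nabla0 nabla a i j l' \o chartV a) (chart a p)
      = partial k' (fun y => T l' y j i) (chart a p).
    apply: (partial_eq_on k' (@ccod_open R n M a)) => // y ay.
    exact: distortion_lowE.
  rewrite [X in _ = _ - X - _ - _]mxE [X in _ = _ - _ - X - _]mxE.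
  rewrite !opprD !addrA; congr (_ - _ - _ - _).
  by apply: eq_bigr => m _; rewrite mulrC [(_^T) m i]mxE.
rewrite /skew_cov_distortion !covE mulrA.
have -> : \sum_m G0 l (chart a p) k m * T m (chart a p) j i
    = \sum_m G0 k (chart a p) l m * T m (chart a p) j i.
  by apply: eq_bigr => m _; rewrite /G0 (torsion_dual_conn_mx _ _ _ lc.2 ax).
have -> : (4 : R) * 2^-1 = 2 by lra.
by rewrite opprB addrA subrK [RHS]mxE; congr (_ * _); rewrite !mxE.
Qed.

Let sb : smooth_brackets M.
Proof. by move=> U X Y; exact: lie_bracket_smooth td. Qed.

Lemma curvature_torsion_dual a p i j k l : cdom a p ->
  curv_low g nabla a i j k l p + curv_low g nablas a j i k l p
  = 4 * skew_cov_distortion g nabla0 nabla a i j k l p.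
Proof.
move=> ap; have ax := chart_ccod ap.
rewrite skew_cov_distortionE // !curv_lowE //.
have := curv_mx_dual (@ccod_open R n M a) (@conn_mx_smooth _ _ _ nabla a)
  (@conn_mx_smooth _ _ _ nablas a) (@conn_mx_smooth _ _ _ nabla0 a)
  (@gram_mx_smooth _ _ _ g a) (@gram_mx_sym _ _ _ g a) (@gram_mx_unit _ _ _ g a)
  (metric_conn_in_chart mn) (metric_conn_in_chart mns)
  (metric_conn_in_chart lc.1)
  (fun k j m x => torsion_dual_conn_mx k j m td)
  (fun k j m x => torsion_dual_conn_mx k j m lc.2) k l ax.
by move/matrixP/(_ j i) => <-; rewrite [RHS]mxE [X in _ = _ + X]mxE.
Qed.

Lemma curv_low_skew (D : connection M) a p i j k l : is_metric g D -> cdom a p ->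
  curv_low g D a j i k l p = - curv_low g D a i j k l p.
Proof.
move=> mD ap; have ax := chart_ccod ap; rewrite !curv_lowE //.
have := curv_mx_metric (@ccod_open R n M a) k l (@conn_mx_smooth _ _ _ D a)
  (@gram_mx_smooth _ _ _ g a) (metric_conn_in_chart mD) ax.
rewrite -{2}(gram_mx_sym g ax) -trmx_mul => /matrixP/(_ i j).
rewrite [LHS]mxE [X in _ + X]mxE [RHS]mxE => /eqP.
by rewrite addr_eq0 => /eqP.
Qed.

Lemma curv_mx_eq0 (D : connection M) a x k l : ccod a x ->
  curv_mx (conn_mx D a) k l x = 0 <->
  forall i j, curv_low g D a i j k l (chartV a x) = 0.
Proof.
move=> ax; have ap := chartV_cdom ax; split=> [K0 i j|K0].
  by rewrite curv_lowE // chartVK // K0 mul0mx mxE.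
apply: (can_inj (mulmxK (gram_mx_unit g ax))); rewrite mul0mx.
apply/matrixP => j i; rewrite [RHS]mxE -(K0 i j) curv_lowE //.
by rewrite chartVK.
Qed.

Lemma flat_curv_low (D : connection M) : flat D <->
  forall a p i j k l, cdom a p -> curv_low g D a i j k l p = 0.
Proof.
split=> [/(flatP _ sb) K0 a p i j k l ap|K0].
  by rewrite curv_lowE // K0 ?mul0mx ?mxE //; exact: chart_ccod.
apply/(flatP _ sb) => a x i j ax; apply/curv_mx_eq0 => // i' j'.
by apply: K0; exact: chartV_cdom.
Qed.

End TorsionDualMetric.

(** * Connections on R^n with prescribed coefficients *)

Section Euclid.
Variables (R : realType) (n : nat).

(** Balls with rational centre and radius of the form 1/(k + 1). *)
Lemma rV_second_countable : @second_countable 'rV[R]_n.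
Proof.
pose b (qk : 'rV[rat]_n * nat) : set 'rV[R]_n :=
  ball (map_mx ratr qk.1 : 'rV[R]_n) (qk.2.+1%:R^-1 : R).
exists (range b).
  by apply: sub_countable (card_image_le _ _) _; exact: countableP.
split.
  by move=> _ [[q k] _ <-]; exact: ball_open.
move=> x V /nbhs_ballP[e e0 xV].
have [|k] := @ltr_add_invr R 0 (e / 2); first by rewrite divr_gt0.
rewrite add0r => ke.
set d : R := k.+1%:R^-1 in ke; have d0 : 0 < d by rewrite invr_gt0.
have xq j : {q : rat | x 0 j - d < ratr q < x 0 j + d}.
  apply/cid; have : x 0 j - d < x 0 j + d by rewrite ltrBlDr -addrA ltrDl addr_gt0.
  by move=> /rat_in_itvoo[q]; rewrite in_itv /= => qx; exists q.
pose q : 'rV[rat]_n := \row_j sval (xq j).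
have qx : ball (map_mx ratr q : 'rV[R]_n) d x.
  split=> // i j; rewrite ord1 /ball /= !mxE.
  by case: (xq j) => r /= /andP[? ?]; rewrite ltr_distlC; apply/andP; split; lra.
exists (b (q, k)).
  by split=> //; exists (q, k).
move=> y qy; apply: xV; apply: le_ball (ltW _) _ (ball_triangle (ball_sym qx) qy).
by rewrite [e]splitr; exact: ltrD.
Qed.

Definition euclid : smoothManifold R n.
Proof.
refine (@SmoothManifold R n 'rV[R]_n (@norm_hausdorff _ _) rV_second_countable unit
  (fun=> setT) (fun=> setT) (fun=> id) (fun=> id) _ _ _ _ _ _ _ _ _ _) => //.
- by move=> _; exact: openT.
- by move=> _; exact: openT.
- by move=> _; apply: continuous_subspaceT => x.
- by move=> _; apply: continuous_subspaceT => x.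
- by move=> _ _ j; exact: smooth_coord.
Defined.

Lemma euclid_chart_image (a : atlas euclid) (U : set euclid) : chart_image a U = U.
Proof. by apply/seteqP; split=> [x []|x Ux]. Qed.

Lemma euclid_transitionJ (a b : atlas euclid) (p : euclid) : transitionJ a b p = 1%:M.
Proof. by case: a; case: b; exact: transitionJ_id. Qed.

Lemma euclid_vfield_smooth (U : set euclid) (X : vfield euclid) (a : atlas euclid) :
  smooth_vfield U X <-> mxsmooth (U : set 'rV[R]_n) (in_chart a X).
Proof.
split=> [sX|sX].
  by have := smooth_vfield_mx (a := a) sX; rewrite euclid_chart_image.
split=> [b c p _ _ _|b].
  by rewrite euclid_transitionJ mulmx1; case: b; case: c.
apply/smooth_map_mx; have -> : b = a by case: a {sX}; case: b.
by move: sX; rewrite -{1}(euclid_chart_image a U).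
Qed.

Lemma euclid_fun_smooth (U : set euclid) (f : euclid -> R) :
  smooth_fun U f -> smooth_on (U : set 'rV[R]_n) f.
Proof.
by move=> /(_ tt) sf; apply: (smooth_on_sub _ sf) => x Ux; split.
Qed.

Section ChristoffelConnection.
Variable G : 'I_n -> 'rV[R]_n -> 'M[R]_n.
Hypothesis sG : forall i, mxsmooth setT (G i).

(** On R^n, any smooth family of coefficient matrices defines a connection. *)
Definition christoffel_cov (X Y : vfield euclid) : vfield euclid := fun p a =>
  \sum_i X p a 0 i *: covd G i (in_chart a Y) p.

Let sGU (U : set 'rV[R]_n) i : mxsmooth U (G i).
Proof. exact: mxsmooth_sub (sG i). Qed.

Let covd_eq (U : set 'rV[R]_n) i Y Y' p : open U -> (forall q, U q -> Y q = Y' q) ->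
  U p -> covd G i Y p = covd G i Y' p.
Proof.
by move=> oU YY Up; rewrite /covd (mxpartial_eq i oU YY Up) YY.
Qed.

Let diff_vfield (U : set euclid) Y a p : smooth_vfield U Y -> U p ->
  mxdiff (in_chart a Y) p.
Proof. by move=> /(euclid_vfield_smooth _ _ a) sY Up; exact: mxsmooth_diff sY Up. Qed.

Definition christoffel_connection : connection euclid.
Proof.
refine (@Connection R n euclid christoffel_cov _ _ _ _ _ _).
- move=> U X Y oU /(euclid_vfield_smooth _ _ tt) sX /(euclid_vfield_smooth _ _ tt) sY.
  apply/(euclid_vfield_smooth _ _ tt); apply: mxsmooth_sum => // i.
  by apply: mxsmoothZ => //; exact: covd_smooth.
- move=> U X X' Y Y' oU sX sX' sY sY' XX YY p a Up ap.
  apply: eq_bigr => i _; rewrite XX //; congr (_ *: _).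
  by apply: (covd_eq i oU) => // q Uq; exact: YY.
- move=> U X X' Y oU sX sX' sY p a Up ap.
  by rewrite /vadd -big_split /=; apply: eq_bigr => i _; rewrite mxE scalerDl.
- move=> U f X Y oU sf sX sY p a Up ap.
  by rewrite /vscale scaler_sumr; apply: eq_bigr => i _; rewrite mxE scalerA.
- move=> U X Y Y' oU sX sY sY' p a Up ap.
  rewrite /vadd -big_split /=; apply: eq_bigr => i _; rewrite -scalerDr; congr (_ *: _).
  rewrite /covd mxpartialD; [|exact: diff_vfield sY Up|exact: diff_vfield sY' Up].
  by rewrite mulmxDl addrACA.
- move=> U f X Y oU sf sX sY p a Up ap.
  have df := smooth_diff (euclid_fun_smooth sf) Up.
  rewrite /vscale /vderive (derive_partial _ df) scaler_suml scaler_sumr -big_split /=.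
  apply: eq_bigr => i _; rewrite /covd mxpartialZ //; last exact: diff_vfield sY Up.
  rewrite /in_chart /=.
  by rewrite -scalemxAl -addrA -scalerDr [LHS]scalerDr !scalerA [f p * _]mulrC.
Defined.

Lemma christoffel_conn_mx a i x : conn_mx christoffel_connection a i x = G i x.
Proof.
apply/row_matrixP => j; have -> : x = chart a x by [].
rewrite row_conn_mx //= /christoffel_cov (bigD1 i) //= big1 ?addr0; last first.
  by move=> k ki; rewrite coord_field_chart // mxE (negPf ki) andbF scale0r.
rewrite coord_field_chart // mxE !eqxx /= scale1r /covd.
rewrite (_ : in_chart a (coord_field a j) = fun=> 'e_j).
  by rewrite mxpartial_cst add0r -rowE.
by apply/funext => y; rewrite /in_chart coord_field_chart.
Qed.

End ChristoffelConnection.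

Lemma christoffel_torsion_dual G Gs (sG : forall i, mxsmooth setT (G i))
    (sGs : forall i, mxsmooth setT (Gs i)) :
  (forall k j m x, Gs k x j m = G j x k m) ->
  torsion_dual (christoffel_connection sG) (christoffel_connection sGs).
Proof.
move=> dual U X Y oU sX sY p a Up ap.
have dX : mxdiff (in_chart a X) p.
  by apply: mxsmooth_diff Up; apply/euclid_vfield_smooth.
have dY : mxdiff (in_chart a Y) p.
  by apply: mxsmooth_diff Up; apply/euclid_vfield_smooth.
rewrite /= /christoffel_cov /lie_bracket.
rewrite -/(in_chart a Y) -/(in_chart a X) (derive_mxpartial _ dX) (derive_mxpartial _ dY).
rewrite /covd; under eq_bigr do rewrite scalerDr.
under [X in _ - X - _]eq_bigr do rewrite scalerDr.
rewrite !big_split /=.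
have -> : \sum_i Y p a 0 i *: (X p a *m Gs i p) = \sum_i X p a 0 i *: (Y p a *m G i p).
  apply/rowP => m; rewrite !summxE.
  under eq_bigr do rewrite !mxE mulr_sumr.
  rewrite exchange_big /=; apply: eq_bigr => i _; rewrite !mxE mulr_sumr.
  by apply: eq_bigr => j _; rewrite dual mulrCA.
by rewrite opprD addrACA subrr addr0 subrr.
Qed.

Section ChartMetric.
Variable gam : 'rV[R]_n -> 'M[R]_n.
Hypothesis sgam : mxsmooth setT gam.
Hypothesis gam_sym : forall x, (gam x)^T = gam x.
Hypothesis gam_posdef : forall x (v : 'rV[R]_n), v != 0 -> 0 < (v *m gam x *m v^T) 0 0.

Definition chart_metric : riemannianMetric euclid.
Proof.
refine (@RiemannianMetric R n euclid (fun p _ => gam p)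
  (fun p _ _ => gam_sym p) (fun p _ _ v => @gam_posdef p v) _ (fun _ => sgam)).
by move=> a b p _ _; rewrite euclid_transitionJ mul1mx trmx1 mulmx1.
Defined.

Lemma christoffel_metric G (sG : forall i, mxsmooth setT (G i)) :
  metric_conn setT G gam -> is_metric chart_metric (christoffel_connection sG).
Proof.
move=> mG U X Y Z oU sX sY sZ p a Up ap.
have dY : mxdiff (in_chart a Y) p.
  by apply: mxsmooth_diff Up; apply/euclid_vfield_smooth.
have sYU := (euclid_vfield_smooth U Y a).1 sY.
have sZU := (euclid_vfield_smooth U Z a).1 sZ.
have sgU : mxsmooth (U : set 'rV[R]_n) gam by exact: mxsmooth_sub sgam.
have sYg := mxsmoothM oU sYU sgU.
have sI := mxsmoothM oU sYg (mxsmooth_tr oU sZU).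
rewrite /cov_metric /vderive.
have -> : 'D_(X p a) (inner chart_metric a Y Z \o chartV a) (chart a p) =
    \sum_i X p a 0 i *
      (mxpartial i (fun y => in_chart a Y y *m gam y *m (in_chart a Z y)^T) p) 0 0.
  rewrite derive_partial; last exact: (mxsmooth_diff sI Up 0 0).
  by apply: eq_bigr => i _; rewrite [in RHS]mxE.
have dg := mxsmooth_diff sgU Up.
have dZ := mxsmooth_diff sZU Up.
have dZt := mxsmooth_diff (mxsmooth_tr oU sZU) Up.
have dYg := mxsmooth_diff sYg Up.
under eq_bigr do rewrite mxpartialM // mxpartialM // mG // mxpartial_tr.
rewrite /inner /= /christoffel_cov !mulmx_suml linear_sum mulmx_sumr.
rewrite [X in _ - X - _]summxE [X in _ - _ - X]summxE -!sumrB big1 // => i _.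
rewrite linearZ /= -!scalemxAl -scalemxAr [X in _ - X - _]mxE [X in _ - _ - X]mxE.
rewrite -!mulrBr; apply/eqP; rewrite mulf_eq0; apply/orP; right; apply/eqP.
have trD (A B : 'rV[R]_n) : (A + B)^T = A^T + B^T by exact: raddfD.
rewrite /covd trD trmx_mul !(mulmxDl, mulmxDr, mulmxA) /in_chart /=.
by mx_generalize; rewrite !mxE; ring.
Qed.

End ChartMetric.

End Euclid.

(** * The flat connection of a cross product *)

Section CrossProduct.

(** [phi a b c] stands for <e_a >< e_b, e_c>.  The contraction identity is the
    polarization of a >< (a >< b) = <a, b> a - |a|^2 b; besides the alternation
    of [phi], it is all that the construction uses. *)
Variables (R : realType) (n : nat) (phi : 'I_n -> 'I_n -> 'I_n -> R).
Hypothesis phi_swap : forall a b c, phi b a c = - phi a b c.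
Hypothesis phi_cycle : forall a b c, phi b c a = phi a b c.
Hypothesis phi_contract : forall c k i j,
  \sum_a phi c k a * phi i j a + \sum_a phi c j a * phi i k a
  = 2 * (c == i)%:R * (k == j)%:R - (c == j)%:R * (k == i)%:R
    - (c == k)%:R * (j == i)%:R.
Implicit Types (x : 'rV[R]_n) (i j k l m a b c : 'I_n).

Let phi_swapr a b c : phi a c b = - phi a b c.
Proof. by rewrite -phi_cycle phi_swap phi_cycle phi_cycle. Qed.

Definition sqnorm x : R := \sum_a x 0 a * x 0 a.

(** For the point of the sphere with stereographic coordinates [x],
    [stereo_minus x / stereo_plus x] is the height, and [(stereo_plus x)^-2] is
    the conformal factor of the round metric. *)
Definition stereo_minus x := (1 - sqnorm x) / 2.
Definition stereo_plus x := (1 + sqnorm x) / 2.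
Definition cross x : 'M[R]_n := \matrix_(a, b) \sum_c x 0 c * phi c a b.

(** Row [a] holds the components of the field
    E_a(x) = (1 - |x|^2)/2 e_a + x_a x + x >< e_a. *)
Definition frame x : 'M[R]_n :=
  \matrix_(a, j) (stereo_minus x * (a == j)%:R + x 0 a * x 0 j + cross x a j).

(** The derivative of [frame] along e_i; see [mxpartial_frame]. *)
Definition dframe i x : 'M[R]_n :=
  \matrix_(a, j) (- x 0 i * (a == j)%:R + (i == a)%:R * x 0 j
     + x 0 a * (i == j)%:R + phi i a j).

Lemma crossN x a b : cross x b a = - cross x a b.
Proof.
rewrite !mxE -sumrN; apply: eq_bigr => c _.
by rewrite phi_swapr mulrN.
Qed.

Lemma sum_deltar (f : 'I_n -> R) j : \sum_a f a * (a == j)%:R = f j.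
Proof.
rewrite (bigD1 j) //= eqxx mulr1 big1 ?addr0 // => a /negPf ->.
by rewrite mulr0.
Qed.

Lemma sum_deltal (f : 'I_n -> R) j : \sum_a f a * (j == a)%:R = f j.
Proof. by under eq_bigr do rewrite eq_sym; exact: sum_deltar. Qed.

Lemma cross_self x j : \sum_a x 0 a * cross x a j = 0.
Proof.
set S := (LHS); suff SN : S = - S.
  by apply/eqP; rewrite -[_ == _](mulrn_eq0 _ 2) mulr2n {2}SN subrr.
rewrite /S; under eq_bigr do rewrite mxE mulr_sumr.
rewrite {1}exchange_big -sumrN; apply: eq_bigr => a _; rewrite -sumrN.
by apply: eq_bigr => c _; rewrite phi_swap; ring.
Qed.

Lemma sum_x_phi x i j : \sum_a x 0 a * phi i a j = - cross x i j.
Proof.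
rewrite mxE -sumrN; apply: eq_bigr => a _.
by rewrite phi_swap mulrN.
Qed.

Definition phi_contraction x k i j := \sum_c x 0 c * (\sum_a phi c k a * phi i j a).

Lemma phi_contractionN x k i j : phi_contraction x k j i = - phi_contraction x k i j.
Proof.
rewrite /phi_contraction -sumrN; apply: eq_bigr => c _; rewrite -mulrN -sumrN; congr (_ * _).
by apply: eq_bigr => a _; rewrite [phi j i a]phi_swap mulrN.
Qed.

Lemma phi_contraction_sym x k i j : phi_contraction x k i j + phi_contraction x j i k
  = 2 * x 0 i * (k == j)%:R - x 0 j * (k == i)%:R - x 0 k * (j == i)%:R.
Proof.
rewrite /phi_contraction -big_split /=; under eq_bigr do rewrite -mulrDr phi_contract.
transitivity (\sum_c (2 * (k == j)%:R * x 0 c * (c == i)%:R)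
   - \sum_c ((k == i)%:R * x 0 c * (c == j)%:R)
   - \sum_c ((j == i)%:R * x 0 c * (c == k)%:R)).
  rewrite -!sumrB; apply: eq_bigr => c _; ring.
rewrite !sum_deltar; ring.
Qed.

Lemma sum_cross_phi x i j k : \sum_a cross x a k * phi i a j = phi_contraction x k i j.
Proof.
rewrite /phi_contraction; under eq_bigr do rewrite mxE mulr_suml.
rewrite exchange_big; apply: eq_bigr => c _; rewrite mulr_sumr.
by apply: eq_bigr => a _; rewrite phi_swapr [phi i a j]phi_swapr; ring.
Qed.

Lemma sum_frame x (f : 'I_n -> R) k : \sum_a frame x a k * f a
  = stereo_minus x * f k + x 0 k * (\sum_a x 0 a * f a) + \sum_a cross x a k * f a.
Proof.
rewrite -[f k in RHS](sum_deltar f) !mulr_sumr -!big_split /=; apply: eq_bigr => a _.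
by rewrite mxE; ring.
Qed.

(** The entry [(k, j)] of [(frame x)^T *m dframe i x].  Up to the factor
    [- conf_factor x] these are the coefficients of the flat connection, and
    [frame_tensor_sym] and [frame_tensor_skew] are the metric equations of this
    connection and of its torsion dual. *)
Definition frame_tensor x i k j := \sum_a frame x a k * dframe i x a j.

Lemma frame_tensorE x i k j : frame_tensor x i k j = stereo_minus x * dframe i x k j
  + x 0 k * (sqnorm x * (i == j)%:R - cross x i j)
  + (- x 0 i * cross x j k + cross x i k * x 0 j + phi_contraction x k i j).
Proof.
rewrite /frame_tensor sum_frame; congr (_ + _ * _ + _).
- transitivity (\sum_a (- x 0 i * x 0 a * (a == j)%:R) + \sum_a x 0 j * x 0 a * (i == a)%:R
    + (i == j)%:R * sqnorm x + \sum_a x 0 a * phi i a j).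
    rewrite /sqnorm mulr_sumr -!big_split /=; apply: eq_bigr => a _; rewrite mxE; ring.
  by rewrite sum_deltar sum_deltal sum_x_phi; ring.
- transitivity (\sum_a (- x 0 i * cross x a k * (a == j)%:R)
    + \sum_a x 0 j * cross x a k * (i == a)%:R
    + (i == j)%:R * (\sum_a x 0 a * cross x a k) + \sum_a cross x a k * phi i a j).
    rewrite mulr_sumr -!big_split /=; apply: eq_bigr => a _; rewrite [dframe _ _ _ _]mxE; ring.
  by rewrite sum_deltar sum_deltal sum_cross_phi cross_self; ring.
Qed.

Lemma frame_tensor_sym x i k j : frame_tensor x i k j + frame_tensor x i j k
  = 2 * stereo_plus x * x 0 i * (k == j)%:R.
Proof.
rewrite !frame_tensorE ![dframe _ _ _ _]mxE (crossN x k j).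
rewrite [phi i j k]phi_swapr.
have -> : phi_contraction x k i j = 2 * x 0 i * (k == j)%:R - x 0 j * (k == i)%:R
    - x 0 k * (j == i)%:R - phi_contraction x j i k by rewrite -phi_contraction_sym addrK.
by rewrite (eq_sym i k) (eq_sym i j) (eq_sym j k) /stereo_plus /stereo_minus; field.
Qed.

Lemma frame_tensor_skew x i k j : frame_tensor x i k j + frame_tensor x j k i
  = 2 * stereo_plus x * x 0 k * (i == j)%:R.
Proof.
rewrite !frame_tensorE ![dframe _ _ _ _]mxE (crossN x i j) (phi_contractionN x k i j).
rewrite [phi j k i]phi_swap [phi k j i]phi_cycle.
by rewrite (eq_sym k j) (eq_sym k i) (eq_sym j i) /stereo_plus /stereo_minus; field.
Qed.

(** What makes the frame orthonormal for the round metric. *)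
Lemma frame_orth x : (frame x)^T *m frame x = (stereo_plus x ^+ 2)%:M.
Proof.
apply/matrixP => k j.
have E : \sum_a frame x a k * frame x a j = (stereo_plus x ^+ 2) * (k == j)%:R.
  rewrite sum_frame.
  have -> : \sum_a x 0 a * frame x a j = stereo_plus x * x 0 j.
    transitivity (\sum_a (stereo_minus x * x 0 a * (a == j)%:R) + x 0 j * sqnorm x
        + \sum_a x 0 a * cross x a j).
      rewrite /sqnorm mulr_sumr -!big_split /=; apply: eq_bigr => a _; rewrite mxE; ring.
    by rewrite sum_deltar cross_self /stereo_plus /stereo_minus; field.
  have -> : \sum_a cross x a k * frame x a j = stereo_minus x * cross x j k
      + \sum_a cross x a k * cross x a j.
    transitivity (\sum_a (stereo_minus x * cross x a k * (a == j)%:R)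
        + x 0 j * (\sum_a x 0 a * cross x a k) + \sum_a cross x a k * cross x a j).
      rewrite mulr_sumr -!big_split /=; apply: eq_bigr => a _; rewrite [frame _ _ _]mxE; ring.
    by rewrite sum_deltar cross_self; ring.
  have CC k' j' : \sum_a cross x a k' * cross x a j'
      = \sum_i x 0 i * phi_contraction x k' i j'.
    under eq_bigr do rewrite [cross x _ j']mxE mulr_sumr.
    rewrite exchange_big; apply: eq_bigr => i _; rewrite -sum_cross_phi mulr_sumr.
    by apply: eq_bigr => a _; ring.
  have -> : \sum_a cross x a k * cross x a j = sqnorm x * (k == j)%:R - x 0 k * x 0 j.
    have : \sum_a cross x a k * cross x a j + \sum_a cross x a j * cross x a k
        = 2 * (sqnorm x * (k == j)%:R - x 0 k * x 0 j).
      rewrite !CC -big_split /=; under eq_bigr do rewrite -mulrDr phi_contraction_sym.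
      transitivity (2 * (k == j)%:R * sqnorm x - \sum_i x 0 i * x 0 j * (k == i)%:R
        - \sum_i x 0 i * x 0 k * (j == i)%:R).
        rewrite /sqnorm mulr_sumr -!sumrB; apply: eq_bigr => i _; ring.
      by rewrite !sum_deltal; ring.
    have -> : \sum_a cross x a j * cross x a k = \sum_a cross x a k * cross x a j.
      by apply: eq_bigr => a _; exact: mulrC.
    by move=> E2; lra.
  by rewrite mxE (crossN x k j) /stereo_plus /stereo_minus; field.
rewrite [LHS]mxE [RHS]mxE -mulr_natr -E; apply: eq_bigr => a _.
by rewrite [(_^T) _ _]mxE.
Qed.

Lemma sqnorm_ge0 x : 0 <= sqnorm x.
Proof. by apply: sumr_ge0 => a _; rewrite -expr2 sqr_ge0. Qed.

Lemma stereo_plus_gt0 x : 0 < stereo_plus x.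
Proof. by rewrite /stereo_plus; have := sqnorm_ge0 x; lra. Qed.

Lemma stereo_plus_neq0 x : stereo_plus x != 0.
Proof. by rewrite gt_eqF // stereo_plus_gt0. Qed.

Let coord_diff x a : differentiable (fun y : 'rV[R]_n => y 0 a) x.
Proof. exact: differentiable_coord. Qed.

Lemma sqnorm_smooth U : open U -> smooth_on U sqnorm.
Proof.
by move=> oU; apply: smooth_sum => // a; apply: smoothM => //; exact: smooth_coord.
Qed.

Lemma stereo_plus_smooth U : open U -> smooth_on U stereo_plus.
Proof.
move=> oU; apply: smoothM => //; last exact: smooth_cst.
by apply: smoothD => //; [exact: smooth_cst|exact: sqnorm_smooth].
Qed.

Lemma stereo_minus_smooth U : open U -> smooth_on U stereo_minus.
Proof.
move=> oU; apply: smoothM => //; last exact: smooth_cst.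
by apply: smoothB => //; [exact: smooth_cst|exact: sqnorm_smooth].
Qed.

Lemma cross_smooth U : open U -> mxsmooth U cross.
Proof.
move=> oU a b.
have : smooth_on U (fun x => \sum_c x 0 c * phi c a b).
  apply: smooth_sum => // c; apply: smoothM => //; first exact: smooth_coord.
  exact: smooth_cst.
by apply: smooth_on_eq => // x _; rewrite mxE.
Qed.

Lemma frame_smooth U : open U -> mxsmooth U frame.
Proof.
move=> oU a j.
have : smooth_on U (fun x => stereo_minus x * (a == j)%:R + x 0 a * x 0 j + cross x a j).
  apply: smoothD => //; last exact: cross_smooth.
  apply: smoothD => //; apply: smoothM => //; try exact: smooth_coord.
    exact: stereo_minus_smooth.
  exact: smooth_cst.
by apply: smooth_on_eq => // x _; rewrite [RHS]mxE.
Qed.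

Lemma partial_sqnorm i x : partial i sqnorm x = 2 * x 0 i.
Proof.
rewrite /sqnorm partial_sum; last by move=> a; exact: differentiableM.
under eq_bigr do rewrite partialM // !partial_coord.
transitivity (\sum_a 2 * x 0 a * (i == a)%:R).
  by apply: eq_bigr => a _; ring.
by rewrite sum_deltal.
Qed.

Let sqnorm_diff x : differentiable sqnorm x.
Proof. by apply: (smooth_diff (sqnorm_smooth openT)). Qed.

Let stereo_plus_diff x : differentiable stereo_plus x.
Proof. by apply: (smooth_diff (stereo_plus_smooth openT)). Qed.

Let stereo_minus_diff x : differentiable stereo_minus x.
Proof. by apply: (smooth_diff (stereo_minus_smooth openT)). Qed.

Lemma partial_stereo_plus i x : partial i stereo_plus x = x 0 i.
Proof.
rewrite /stereo_plus partialM //; last exact: differentiableD.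
by rewrite partialD // !partial_cst partial_sqnorm; field.
Qed.

Lemma partial_stereo_minus i x : partial i stereo_minus x = - x 0 i.
Proof.
rewrite /stereo_minus partialM //; last exact: differentiableB.
by rewrite partialB // !partial_cst partial_sqnorm; field.
Qed.

Lemma partial_cross i a b x : partial i (fun y => cross y a b) x = phi i a b.
Proof.
rewrite (_ : (fun y => cross y a b) =
    fun y : 'rV[R]_n => \sum_c y 0 c * phi c a b); last first.
  by apply/funext => y; rewrite mxE.
rewrite partial_sum; last by move=> c; exact: differentiableM.
under eq_bigr do rewrite partialM // partial_coord partial_cst mulr0 addr0 mulrC.
exact: (sum_deltal (fun c => phi c a b)).
Qed.

Lemma mxpartial_frame i x : mxpartial i frame x = dframe i x.
Proof.
apply/matrixP => a j; rewrite [LHS]mxE [RHS]mxE.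
rewrite (_ : (fun y => frame y a j) =
    fun y => stereo_minus y * (a == j)%:R + y 0 a * y 0 j + cross y a j); last first.
  by apply/funext => y; rewrite mxE.
have d1 : differentiable (fun y => stereo_minus y * (a == j)%:R) x by exact: differentiableM.
have d2 : differentiable (fun y : 'rV[R]_n => y 0 a * y 0 j) x by exact: differentiableM.
rewrite partialD; [|exact: differentiableD|]; last first.
  exact: (mxsmooth_diff (cross_smooth openT)).
rewrite partialD // partialM // partialM // !partial_coord partial_cst partial_stereo_minus.
by rewrite partial_cross; ring.
Qed.

Definition conf_factor x := (stereo_plus x) ^- 2.

(** The inverse of [frame x], because the frame is orthogonal up to a factor. *)
Definition coframe x := conf_factor x *: (frame x)^T.

Lemma conf_factor_smooth U : open U -> smooth_on U conf_factor.
Proof.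
move=> oU; have sq := stereo_plus_smooth oU.
have := smoothV oU (fun x _ => mulf_neq0 (stereo_plus_neq0 x) (stereo_plus_neq0 x))
  (smoothM oU sq sq).
by apply: smooth_on_eq => // x _; rewrite /conf_factor expr2.
Qed.

Lemma partial_conf_factor i x : partial i conf_factor x = - 2 * x 0 i * (stereo_plus x) ^- 3.
Proof.
rewrite (_ : conf_factor = fun y => (stereo_plus y * stereo_plus y)^-1); last first.
  by apply/funext => y; rewrite /conf_factor expr2.
rewrite partialV; [|exact: differentiableM|by rewrite mulf_neq0 ?stereo_plus_neq0].
by rewrite partialM // partial_stereo_plus; field; exact: stereo_plus_neq0.
Qed.

Lemma coframeK x : coframe x *m frame x = 1%:M.
Proof.
rewrite /coframe -scalemxAl frame_orth scale_scalar_mx /conf_factor mulVf //.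
by rewrite expf_neq0 // stereo_plus_neq0.
Qed.

Lemma frameK x : frame x *m coframe x = 1%:M.
Proof. exact: mulmx1C (coframeK x). Qed.

Lemma coframe_smooth U : open U -> mxsmooth U coframe.
Proof.
move=> oU; apply: mxsmoothZ => //; first exact: conf_factor_smooth.
by apply: mxsmooth_tr => //; exact: frame_smooth.
Qed.

Lemma dframe_smooth U i : open U -> mxsmooth U (dframe i).
Proof.
move=> oU; apply: (mxsmooth_eq oU _ (mxsmooth_partial i (frame_smooth oU))).
by move=> x _; exact: mxpartial_frame.
Qed.

(** The frame is parallel when 0 = d_i frame + frame G_i, that is
    G_i = - coframe (d_i frame). *)
Definition frame_conn_mx i x := - (coframe x *m dframe i x).

(** The torsion dual exchanges the direction of differentiation with the index
    of the differentiated field. *)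
Definition dual_conn_mx k x : 'M[R]_n := \matrix_(j, m) frame_conn_mx j x k m.
Definition conf_gram x : 'M[R]_n := (conf_factor x)%:M.

Lemma frame_conn_mx_smooth U i : open U -> mxsmooth U (frame_conn_mx i).
Proof.
move=> oU; apply: mxsmoothN => //; apply: mxsmoothM => //.
  exact: coframe_smooth.
exact: dframe_smooth.
Qed.

Lemma dual_conn_mx_smooth U k : open U -> mxsmooth U (dual_conn_mx k).
Proof.
move=> oU j m; apply: (smooth_on_eq oU _ (frame_conn_mx_smooth j oU k m)).
by move=> x _; rewrite [RHS]mxE.
Qed.

Lemma frame_conn_mxE i x k j : frame_conn_mx i x k j = - conf_factor x * frame_tensor x i k j.
Proof.
rewrite /frame_conn_mx /coframe -scalemxAl !mxE mulNr; congr (- (_ * _)).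
by apply: eq_bigr => a _; rewrite mxE.
Qed.

Lemma conf_gram_smooth U : open U -> mxsmooth U conf_gram.
Proof.
move=> oU i j; have := smoothM oU (conf_factor_smooth oU) (@smooth_cst _ _ U (i == j)%:R).
by apply: smooth_on_eq => // x _; rewrite mxE mulr_natr.
Qed.

Lemma conf_gram_posdef x (v : 'rV[R]_n) : v != 0 -> 0 < (v *m conf_gram x *m v^T) 0 0.
Proof.
move=> v0; rewrite /conf_gram mul_mx_scalar -scalemxAl mxE mulr_gt0 //.
  by rewrite /conf_factor invr_gt0 exprn_gt0 // stereo_plus_gt0.
rewrite mxE lt_def; apply/andP; split; last first.
  by apply: sumr_ge0 => a _; rewrite mxE -expr2 sqr_ge0.
apply: contra v0; rewrite psumr_eq0 => [/allP v0|a _]; last first.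
  by rewrite mxE -expr2 sqr_ge0.
apply/eqP/rowP => a; rewrite [RHS]mxE; apply/eqP.
by have := v0 a (mem_index_enum a); rewrite /= mxE -expr2 sqrf_eq0.
Qed.

Lemma mxpartial_conf_gram k x : mxpartial k conf_gram x = (partial k conf_factor x)%:M.
Proof.
apply/matrixP => i j; rewrite [LHS]mxE [RHS]mxE.
rewrite (_ : (fun y => conf_gram y i j) = fun y => conf_factor y * (i == j)%:R); last first.
  by apply/funext => y; rewrite mxE mulr_natr.
rewrite partialM // ?partial_cst ?mulr0 ?addr0 ?mulr_natr //.
exact: (smooth_diff (conf_factor_smooth openT)).
Qed.

Lemma metric_frame_conn : metric_conn setT frame_conn_mx conf_gram.
Proof.
move=> k x _; rewrite mxpartial_conf_gram /conf_gram mul_mx_scalar mul_scalar_mx -scalerDr.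
apply/matrixP => i j; rewrite [LHS]mxE [RHS]mxE [X in _ * X]mxE [(_^T) _ _]mxE.
rewrite !frame_conn_mxE -mulrDr frame_tensor_sym -mulr_natr partial_conf_factor /conf_factor.
by field; exact: stereo_plus_neq0.
Qed.

Lemma metric_dual_conn : metric_conn setT dual_conn_mx conf_gram.
Proof.
move=> k x _; rewrite mxpartial_conf_gram /conf_gram mul_mx_scalar mul_scalar_mx -scalerDr.
apply/matrixP => i j; rewrite [LHS]mxE [RHS]mxE [X in _ * X]mxE [(_^T) _ _]mxE.
rewrite [dual_conn_mx _ _ i j]mxE [dual_conn_mx _ _ j i]mxE.
rewrite !frame_conn_mxE -mulrDr frame_tensor_skew -mulr_natr partial_conf_factor /conf_factor.
by field; exact: stereo_plus_neq0.
Qed.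

Lemma mxpartial_coframe i x :
  mxpartial i coframe x = - (coframe x *m dframe i x *m coframe x).
Proof.
have dF := mxsmooth_diff (frame_smooth openT) (I : setT x).
have dP := mxsmooth_diff (coframe_smooth openT) (I : setT x).
have : mxpartial i (fun y => coframe y *m frame y) x = 0.
  rewrite -(mxpartial_cst i (1%:M : 'M[R]_n) x); apply: (mxpartial_eq i openT) => // y _.
  exact: coframeK.
rewrite mxpartialM // mxpartial_frame => /(congr1 (mulmx^~ (coframe x))).
rewrite mulmxDl -[mxpartial _ _ _ *m _ *m _]mulmxA frameK mulmx1 mul0mx => /eqP.
by rewrite addr_eq0 => /eqP.
Qed.

Lemma mxpartial_frame_conn i j x : mxpartial i (frame_conn_mx j) x
  = coframe x *m dframe i x *m (coframe x *m dframe j x)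
    - coframe x *m mxpartial i (dframe j) x.
Proof.
have dP := mxsmooth_diff (coframe_smooth openT) (I : setT x).
have dD := mxsmooth_diff (dframe_smooth j openT) (I : setT x).
rewrite mxpartialN; last exact: (mxsmooth_diff (mxsmoothM openT (coframe_smooth openT)
  (dframe_smooth j openT)) (I : setT x)).
by rewrite mxpartialM // mxpartial_coframe mulNmx opprD opprK !mulmxA.
Qed.

Lemma dframe_sym i j x : mxpartial i (dframe j) x = mxpartial j (dframe i) x.
Proof.
have E k : dframe k = mxpartial k frame by apply/funext => y; rewrite mxpartial_frame.
by rewrite !E; exact: (mxschwarz _ _ openT (frame_smooth openT)).
Qed.

(** As d_i coframe = - coframe (d_i frame) coframe, the quadratic terms of the
    curvature cancel against the derivatives of [coframe], while the second
    derivatives of [frame] are symmetric. *)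
Lemma curv_frame_conn i j x : curv_mx frame_conn_mx i j x = 0.
Proof.
rewrite /curv_mx !mxpartial_frame_conn (dframe_sym i j) /frame_conn_mx.
rewrite !(mulNmx, mulmxN) !opprK.
by mx_generalize; apply/matrixP => r s; rewrite !mxE; ring.
Qed.

Lemma mxpartial_dframe k j l m x : mxpartial k (dframe j) x l m
  = - (k == j)%:R * (l == m)%:R + (j == l)%:R * (k == m)%:R + (k == l)%:R * (j == m)%:R.
Proof.
rewrite [LHS]mxE (_ : (fun y => dframe j y l m) = fun y : 'rV[R]_n =>
    - y 0 j * (l == m)%:R + (j == l)%:R * y 0 m + y 0 l * (j == m)%:R + phi j l m); last first.
  by apply/funext => y; rewrite mxE.
have dN : differentiable (fun y : 'rV[R]_n => - y 0 j) x by exact: differentiableN.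
have d1 : differentiable (fun y : 'rV[R]_n => - y 0 j * (l == m)%:R) x.
  exact: differentiableM.
have d2 : differentiable (fun y : 'rV[R]_n => (j == l)%:R * y 0 m) x.
  exact: differentiableM.
have d3 : differentiable (fun y : 'rV[R]_n => y 0 l * (j == m)%:R) x.
  exact: differentiableM.
rewrite partialD //; last by apply: differentiableD => //; exact: differentiableD.
rewrite partialD //; last exact: differentiableD.
rewrite partialD // partialM // partialM // partialM // partialN // !partial_coord.
by rewrite !partial_cst; ring.
Qed.

Lemma dframe0 i a j : dframe i 0 a j = phi i a j.
Proof. by rewrite !mxE; ring. Qed.

Lemma coframe0 : coframe 0 = 2%:M.
Proof.
have s0 : sqnorm 0 = 0 by rewrite /sqnorm big1 // => a _; rewrite mxE mul0r.
apply/matrixP => a j; rewrite !mxE big1 => [|c _]; last by rewrite mxE mul0r.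
by rewrite /conf_factor /stereo_plus /stereo_minus s0 -mulr_natr (eq_sym a j); field.
Qed.

(** Indices chosen distinct so as to drop all the Kronecker deltas that come
    from the second derivatives of [frame]. *)
Lemma curv_dual_conn0 k l j m : j != k -> j != l -> m != k -> m != l -> j != m -> k != l ->
  curv_mx dual_conn_mx k l 0 j m = 4 * \sum_a
    (phi k l a * phi j a m - phi l k a * phi j a m
     + phi j l a * phi a k m - phi j k a * phi a l m).
Proof.
move=> jk jl mk ml jm kl.
have flat0 i a b : frame_conn_mx i 0 a b = - 2 * phi i a b.
  by rewrite /frame_conn_mx coframe0 mul_scalar_mx mxE [X in - X]mxE dframe0 mulNr.
have dual0 i a b : dual_conn_mx i 0 a b = - 2 * phi a i b by rewrite mxE flat0.
have dd a b : a != b -> j != a -> m != a ->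
    mxpartial a (dual_conn_mx b) 0 j m = 4 * \sum_c phi a b c * phi j c m.
  move=> ab ja ma.
  have -> : mxpartial a (dual_conn_mx b) 0 j m = mxpartial a (frame_conn_mx j) 0 b m.
    by rewrite [LHS]mxE [RHS]mxE; apply: eq_partial => y; rewrite mxE.
  rewrite mxpartial_frame_conn coframe0 !mul_scalar_mx -scalemxAl -scalemxAr scalerA.
  have subE (A B : 'M[R]_n) : (A - B) b m = A b m - B b m by rewrite !mxE.
  rewrite subE [X in _ - X]mxE mxpartial_dframe (eq_sym a j) (eq_sym a m).
  rewrite (negPf ab) (negPf ja) (negPf ma) !(mulr0n, oppr0, mul0r, mulr0, addr0).
  rewrite [LHS]mxE -natrM; congr (_ * _); rewrite [LHS]mxE.
  by apply: eq_bigr => c _; rewrite !dframe0.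
have subE (A B C D : 'M[R]_n) : (A - B + C - D) j m = A j m - B j m + C j m - D j m.
  by rewrite !mxE.
rewrite /curv_mx subE dd // dd // 1?eq_sym //.
rewrite [(_ *m _) j m]mxE [X in _ - X]mxE.
have prodE a b : \sum_c dual_conn_mx a 0 j c * dual_conn_mx b 0 c m
    = 4 * \sum_c phi j a c * phi c b m.
  rewrite mulr_sumr; apply: eq_bigr => c _; rewrite !dual0; ring.
rewrite !prodE -!mulrBr -mulrDr -mulrBr -!sumrB -big_split -sumrB /=.
by congr (_ * _).
Qed.

End CrossProduct.

(** * The seven-sphere *)

Section Octonions.
Variable R : realType.

(** The octonion units satisfy e_a e_(a+1) = e_(a+3) with indices modulo 7;
    the triples (a, a+1, a+3) are the oriented lines of the Fano plane. *)
Definition fano (a b c : nat) : bool := (b == (a + 1) %% 7)%N && (c == (a + 3) %% 7)%N.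

Definition fano_cyclic (a b c : nat) : bool := [|| fano a b c, fano b c a | fano c a b].

(** Integer structure constants, on natural indices, so that identities
    between them can be decided by computation. *)
Definition oct_constz (a b c : nat) : int := (fano_cyclic a b c)%:Z - (fano_cyclic b a c)%:Z.

Definition oct_const (a b c : 'I_7) : R := (oct_constz a b c)%:~R.

Lemma oct_const_swap a b c : oct_const b a c = - oct_const a b c.
Proof. by rewrite /oct_const /oct_constz -mulrNz opprB. Qed.

Lemma oct_const_cycle a b c : oct_const b c a = oct_const a b c.
Proof.
rewrite /oct_const /oct_constz; congr (_%:~R); congr (_%:Z - _%:Z); rewrite /fano_cyclic.
  by case: (fano b c a); case: (fano c a b); case: (fano a b c).
by case: (fano c b a); case: (fano b a c); case: (fano a c b).
Qed.

Definition sum7 (f : nat -> int) : int := foldr (fun a s => f a + s) 0 (iota 0 7).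

Lemma sum7E (f : nat -> int) : \sum_(a < 7) (f a)%:~R = (sum7 f)%:~R :> R.
Proof. by rewrite -(big_mkord xpredT (fun a => (f a)%:~R)) -rmorph_sum unlock. Qed.

Definition oct_constz_contract (c k i j : nat) : bool :=
  sum7 (fun a => oct_constz c k a * oct_constz i j a)
  + sum7 (fun a => oct_constz c j a * oct_constz i k a)
  == 2 * (c == i)%:Z * (k == j)%:Z - (c == j)%:Z * (k == i)%:Z - (c == k)%:Z * (j == i)%:Z.

Lemma oct_constz_contractT :
  all (fun c => all (fun k => all (fun i => all (oct_constz_contract c k i) (iota 0 7))
    (iota 0 7)) (iota 0 7)) (iota 0 7).
Proof. by vm_compute. Qed.

Lemma oct_const_contract c k i j :
  \sum_a oct_const c k a * oct_const i j a + \sum_a oct_const c j a * oct_const i k a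
  = 2 * (c == i)%:R * (k == j)%:R - (c == j)%:R * (k == i)%:R
    - (c == k)%:R * (j == i)%:R.
Proof.
have in7 (a : 'I_7) : val a \in iota 0 7 by rewrite mem_iota /=.
have sumE (c' k' i' j' : 'I_7) : \sum_a oct_const c' k' a * oct_const i' j' a
    = (sum7 (fun a => oct_constz c' k' a * oct_constz i' j' a))%:~R.
  by rewrite -sum7E; apply: eq_bigr => a _; rewrite intrM.
have /allP/(_ _ (in7 c))/allP/(_ _ (in7 k))/allP/(_ _ (in7 i))/allP/(_ _ (in7 j)) :=
  oct_constz_contractT.
rewrite !sumE -intrD => /eqP ->.
by rewrite !(intrB, intrM).
Qed.

(** The units e_0, e_1, e_2 do not associate: (e_0 e_1) e_2 = e_3 e_2 = - e_5
    whereas e_0 (e_1 e_2) = e_0 e_4 = e_5.  This is why these indices, together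
    with 5, give a component that does not vanish. *)
Lemma oct_const_dual_curved : curv_mx (dual_conn_mx oct_const) (Ordinal (isT : 1 < 7)%N)
  (Ordinal (isT : 2 < 7)%N) 0 (Ordinal (isT : 0 < 7)%N) (Ordinal (isT : 5 < 7)%N) != 0.
Proof.
rewrite (curv_dual_conn0 oct_const_swap oct_const_cycle oct_const_contract) //.
set z := sum7 (fun a => oct_constz 1 2 a * oct_constz 0 a 5
  - oct_constz 2 1 a * oct_constz 0 a 5
  + oct_constz 0 2 a * oct_constz a 1 5 - oct_constz 0 1 a * oct_constz a 2 5).
rewrite (_ : \sum_a _ = z%:~R); last first.
  rewrite /z -sum7E; apply: eq_bigr => a _.
  by rewrite /oct_const /oct_constz !(intrB, intrD, intrM).
by rewrite mulf_neq0 ?pnatr_eq0 // intr_eq0.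
Qed.

End Octonions.

Section Sphere.
Variable R : realType.
Let phi := @oct_const R.
Let G := frame_conn_mx phi.
Let Gs := dual_conn_mx phi.

Let sG i : mxsmooth setT (G i).
Proof. exact: frame_conn_mx_smooth openT. Qed.

Let sGs i : mxsmooth setT (Gs i).
Proof. exact: dual_conn_mx_smooth openT. Qed.

Let g : riemannianMetric (euclid R 7) :=
  chart_metric (conf_gram_smooth openT) (fun x => tr_scalar_mx _ _) (@conf_gram_posdef R 7).

(** The flat connection of the octonion frame on the stereographic chart of
    S^7. *)
Lemma flat_with_curved_dual :
  exists (n : nat) (M : smoothManifold R n) (g : riemannianMetric M)
     (nabla nablas : connection M),
     [/\ torsion_dual nabla nablas, is_metric g nabla, is_metric g nablas,
         flat nabla & ~ flat nablas].
Proof.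
exists 7, (euclid R 7), g, (christoffel_connection sG), (christoffel_connection sGs).
have td : torsion_dual (christoffel_connection sG) (christoffel_connection sGs).
  by apply: christoffel_torsion_dual => k j m x; rewrite [LHS]mxE.
have sb : smooth_brackets (euclid R 7).
  by move=> U X Y; exact: lie_bracket_smooth td.
have connE (H : 'I_7 -> 'rV[R]_7 -> 'M[R]_7) (sH : forall i, mxsmooth setT (H i)) a :
    conn_mx (christoffel_connection sH) a = H.
  by apply/funext => i; apply/funext => x; exact: christoffel_conn_mx.
split=> //.
- apply: christoffel_metric.
  exact: (metric_frame_conn (@oct_const_swap R) (@oct_const_cycle R) (@oct_const_contract R)).
- apply: christoffel_metric.
  exact: (metric_dual_conn (@oct_const_swap R) (@oct_const_cycle R)).
- apply/(flatP _ sb) => a x i j _; rewrite connE.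
  exact: (curv_frame_conn (@oct_const_swap R) (@oct_const_cycle R) (@oct_const_contract R)).
- move=> /(flatP _ sb) fl; have /eqP := oct_const_dual_curved R; apply.
  have /matrixP/(_ (Ordinal (isT : 0 < 7)%N) (Ordinal (isT : 5 < 7)%N)) :=
    fl tt 0 (Ordinal (isT : 1 < 7)%N) (Ordinal (isT : 2 < 7)%N) I.
  by rewrite connE [RHS]mxE.
Qed.

End Sphere.

Theorem theorem2 (R : realType) :
  (forall (n : nat) (M : smoothManifold R n) (g : riemannianMetric M)
     (nabla nablas nabla0 : connection M),
     torsion_dual nabla nablas ->
     is_metric g nabla -> is_metric g nablas ->
     levi_civita g nabla0 ->
     [/\ (forall (a : atlas M) (p : M) (i j k l : 'I_n), cdom a p ->
            curv_low g nabla a i j k l p + curv_low g nablas a j i k l p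
            = 4 * skew_cov_distortion g nabla0 nabla a i j k l p),
         (flat nabla ->
            forall (a : atlas M) (p : M) (i j k l : 'I_n), cdom a p ->
            curv_low g nablas a j i k l p
            = 4 * skew_cov_distortion g nabla0 nabla a i j k l p),
         (forall (a : atlas M) (p : M) (i j k l : 'I_n), cdom a p ->
            curv_low g nablas a i j k l p = 0 <->
            curv_low g nabla a i j k l p
            = 4 * skew_cov_distortion g nabla0 nabla a i j k l p),
         (flat nabla ->
            (flat nablas <->
             forall (a : atlas M) (p : M) (i j k l : 'I_n), cdom a p ->
               skew_cov_distortion g nabla0 nabla a i j k l p = 0)) &
         (flat nablas ->
            (flat nabla <->
             forall (a : atlas M) (p : M) (i j k l : 'I_n), cdom a p ->
               skew_cov_distortion g nabla0 nabla a i j k l p = 0))])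
  /\
  (exists (n : nat) (M : smoothManifold R n) (g : riemannianMetric M)
     (nabla nablas : connection M),
     [/\ torsion_dual nabla nablas, is_metric g nabla, is_metric g nablas,
         flat nabla & ~ flat nablas]).
Proof.
split; last exact: flat_with_curved_dual.
move=> n M g nabla nablas nabla0 td mn mns lc.
have sumE a p i j k l (ap : cdom a p) :=
  curvature_torsion_dual td mn mns lc i j k l ap.
have skew a p i j k l (ap : cdom a p) : curv_low g nablas a j i k l p = _ :=
  curv_low_skew td i j k l mns ap.
have n4 : (4 : R) != 0 by rewrite pnatr_eq0.
split.
- exact: sumE.
- by move=> /(flat_curv_low g td) fl a p i j k l ap; rewrite -sumE // fl // add0r.
- move=> a p i j k l ap; rewrite -sumE // (skew a p i j k l ap); split=> [->|/eqP].
    by rewrite oppr0 addr0.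
  by rewrite -subr_eq0 opprB addrC subrK => /eqP.
- move=> /(flat_curv_low g td) fl; split=> [/(flat_curv_low g td) fls|sk0].
    move=> a p i j k l ap; apply: (mulfI n4).
    by rewrite -sumE // fl // fls // addr0 mulr0.
  apply/(flat_curv_low g td) => a p i j k l ap.
  by have := sumE a p j i k l ap; rewrite sk0 // mulr0 fl // add0r.
- move=> /(flat_curv_low g td) fls; split=> [/(flat_curv_low g td) fl|sk0].
    move=> a p i j k l ap; apply: (mulfI n4).
    by rewrite -sumE // fl // fls // addr0 mulr0.
  apply/(flat_curv_low g td) => a p i j k l ap.
  by have := sumE a p i j k l ap; rewrite sk0 // mulr0 fls // addr0.
Qed.
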